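(* Let $M$ be a smooth compact $n$-dimensional manifold-with-boundary with a smooth one-parameter family of Riemannian metrics $g(t)$ and functions $f(t)\in C^\infty(M)$ such that $H + e_0 f = 0$ on $\partial M$ for all $t$. Under the assumptions $$\frac{\partial g}{\partial t} = -2(\operatorname{Ric} + \operatorname{Hess}(f)),\qquad \frac{\partial f}{\partial t} = -\triangle f - R,$$ on $\partial M$ we have $$\frac{\partial g_{ij}}{\partial t} = -(\mathcal L_{\widehat\nabla f}\,g)_{ij} - 2R_{ij} - 2HA_{ij},$$ $$\frac{\partial A_{ij}}{\partial t} = (\widehat\triangle A)_{ij} - (\mathcal L_{\widehat\nabla f}A)_{ij} - A^k_{\ i}R^l_{\ klj} - A^k_{\ j}R^l_{\ kli} + 2A^{kl}R_{kilj} - 2HA_{ik}A^k_{\ j} + A^{kl}A_{kl}A_{ij} + \nabla_0R_{0i0j}$$ and $$\frac{\partial H}{\partial t} = \widehat\triangle H - \langle\widehat\nabla f,\widehat\nabla H\rangle + 2A^{ij}R_{ij} + A^{ij}A_{ij}H + \nabla_0R_{00}.$$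
   Context: All quantities at time $t$ are with respect to $g(t)$. $\operatorname{Ric}=(R_{\alpha\beta})$ and $R$ are the Ricci and scalar curvature of $M$, $\operatorname{Hess}(f)=(\nabla_\alpha\nabla_\beta f)$, $\triangle$ is the Laplacian (trace of the Hessian). $e_0$ is the inward-pointing unit normal on $\partial M$, $A(X,Y)=g(e_0,\nabla_XY)$ is the second fundamental form of $\partial M$, $H=g^{ij}A_{ij}$ the mean curvature; $\widehat\nabla$ is the Levi-Civita connection of the induced metric on $\partial M$, $\widehat\triangle=g^{ij}\widehat\nabla_i\widehat\nabla_j$ (acting on functions and tensors on $\partial M$), and $\mathcal L_{\widehat\nabla f}$ is the Lie derivative on $\partial M$ along the gradient $\widehat\nabla f$ of $f|_{\partial M}$. Summation convention: Latin indices $i,j,k,l$ run only over the $n-1$ directions tangent to $\partial M$ (so $R^l_{\ klj}$ is a sum over tangential $l$ only) and the index $0$ denotes the direction $e_0$; $g_{ij}$ on $\partial M$ is the induced metric. $R_{\alpha\beta\gamma\delta}$ is the Riemann curvature tensor of $M$, with sign convention such that $R_{\beta\delta}=R^\alpha_{\ \beta\alpha\delta}$ (so $R_{\alpha\beta\alpha\beta}>0$ on round spheres for orthonormal directions). $\nabla_0R_{0i0j}$ and $\nabla_0R_{00}$ denote components of the covariant derivatives in $M$: $(\nabla_{e_0}\mathrm{Rm})(e_0,\partial_i,e_0,\partial_j)$ and $(\nabla_{e_0}\operatorname{Ric})(e_0,e_0)$. *)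

(* Defs.v *)
From HB Require Import structures.
From mathcomp Require Import all_boot all_order all_algebra.
From mathcomp Require Import all_classical all_reals all_analysis.

Set Implicit Arguments.
Unset Strict Implicit.
Unset Printing Implicit Defensive.

Import Order.TTheory GRing.Theory Num.Theory.
Import numFieldNormedType.Exports.

Local Open Scope classical_set_scope.
Local Open Scope ring_scope.

(* Half-spaces and time intervals have boundary points, so the difference
   quotient at [x] only ranges over increments that stay inside the domain [D];
   it is one-sided exactly when [D] has room on one side of [x] only, and it is
   the usual directional derivative when [x] is interior to [D]. *)
Section Calculus.
Context {R : realType} {V : normedModType R}.
Implicit Types (D : set V) (v x : V) (f : V -> R).

Definition dquot D v f x : set_system R :=
  h^-1 * (f (x + h *: v) - f x) @[h --> within [set h | D (x + h *: v)] 0^'].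

Definition is_pd D v f x (l : R) : Prop := dquot D v f x --> l.

Definition pd D v f x : R := lim (dquot D v f x).

Definition pds D (vs : seq V) f : V -> R := foldr (pd D) f vs.

(* [B] is the set of coordinate directions.  All iterated partial derivatives
   exist on [D] and are continuous on [D], up to the boundary points in [D]. *)
Definition smooth_on (B D : set V) f : Prop :=
  forall vs : seq V, (forall v, v \in vs -> B v) ->
    {within D, continuous (pds D vs f)} /\
    (forall v x, B v -> D x -> cvg (dquot D v (pds D vs f) x)).

End Calculus.

Section Coordinates.
Context {R : realType}.

Definition ebase {d : nat} (i : 'I_d) : 'rV[R]_d := delta_mx 0 i.

Definition space_dirs (d : nat) : set 'rV[R]_d := [set ebase i | i in [set: 'I_d]].

Definition spacetime_dirs (d : nat) : set (R * 'rV[R]_d) :=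
  [set (1, 0)] `|` [set (0, ebase i) | i in [set: 'I_d]].

Definition halfspace (m : nat) : set 'rV[R]_m.+1 := [set x | 0 <= x 0 ord0].

(* The inclusion y |-> (0, y) of the boundary hyperplane; the tangential
   coordinate [i : 'I_m] is the coordinate [lift ord0 i : 'I_m.+1]. *)
Definition bpt {m : nat} (y : 'rV[R]_m) : 'rV[R]_m.+1 :=
  \row_(a < m.+1) (if unlift ord0 a is Some i then y 0 i else 0).

End Coordinates.
Arguments space_dirs R d : clear implicits.
Arguments spacetime_dirs R d : clear implicits.
Arguments halfspace R m : clear implicits.

(* The manifold has dimension m + 1 and its boundary has dimension m.  The atlas
   need not be maximal, and [cinv c] matters on [cmap c @` cdom c] only. *)
Record bmanifold (R : realType) (m : nat) := BManifold {
  bm_space :> topologicalType;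
  chart : Type;
  cdom : chart -> set bm_space;
  cmap : chart -> bm_space -> 'rV[R]_m.+1;
  cinv : chart -> 'rV[R]_m.+1 -> bm_space;
  bm_hausdorff : hausdorff_space bm_space;
  bm_second_countable : @second_countable bm_space;
  cdom_open : forall c, open (cdom c);
  cdom_cover : forall p, exists c, cdom c p;
  crange_open : forall c,
    exists2 O : set 'rV[R]_m.+1,
      open O & cmap c @` cdom c = O `&` halfspace R m;
  cmapK : forall c p, cdom c p -> cinv c (cmap c p) = p;
  cmap_continuous : forall c, {within cdom c, continuous (cmap c)};
  cinv_continuous : forall c, {within cmap c @` cdom c, continuous (cinv c)};
  transition_smooth : forall (c c' : chart) (k : 'I_m.+1),
    smooth_on (space_dirs R m.+1) (cmap c @` (cdom c `&` cdom c'))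
      (fun x => cmap c' (cinv c x) 0 k)
}.

Section Families.
Context {R : realType} {m : nat} (M : bmanifold R m).

Definition crange (c : chart M) : set 'rV[R]_m.+1 := cmap c @` cdom c.

(* The part of the boundary of [M] seen by [c], in boundary coordinates. *)
Definition bdry (c : chart M) : set 'rV[R]_m := bpt @^-1` crange c.

Definition overlap (c c' : chart M) : set 'rV[R]_m.+1 :=
  cmap c @` (cdom c `&` cdom c').

Definition transition_map (c c' : chart M) (x : 'rV[R]_m.+1) : 'rV[R]_m.+1 :=
  cmap c' (cinv c x).

Definition jacobian (c c' : chart M) (x : 'rV[R]_m.+1) : 'M[R]_m.+1 :=
  \matrix_(a, b) pd (overlap c c') (ebase a) (fun z => transition_map c c' z 0 b) x.

(* [g c t x] is the matrix of components of g(t) in the chart [c], at the point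
   with coordinates [x]. *)
Definition smooth_metrics (J : set R)
    (g : chart M -> R -> 'rV[R]_m.+1 -> 'M[R]_m.+1) : Prop :=
  [/\ forall c a b,
        smooth_on (spacetime_dirs R m.+1) (J `*` crange c)
          (fun z => g c z.1 z.2 a b),
      forall c t x, J t -> crange c x -> (g c t x)^T = g c t x,
      forall c t x, J t -> crange c x ->
        forall v : 'rV[R]_m.+1, v != 0 -> 0 < (v *m g c t x *m v^T) 0 0 &
      forall c c' t x, J t -> overlap c c' x ->
        g c t x = jacobian c c' x *m g c' t (transition_map c c' x)
                  *m (jacobian c c' x)^T].

Definition in_chart (c : chart M) (f : M -> R) : 'rV[R]_m.+1 -> R :=
  fun x => f (cinv c x).

Definition smooth_functions (J : set R) (f : R -> M -> R) : Prop :=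
  forall c, smooth_on (spacetime_dirs R m.+1) (J `*` crange c)
              (fun z => in_chart c (f z.1) z.2).

End Families.

(* A metric with component matrix [G] on a coordinate domain [D] of R^d.  Tensor
   fields are given by their components; in [nablaN T k i ...] the first index
   is the direction of differentiation. *)
Section LocalGeometry.
Context {R : realType} {d : nat}.
Variables (D : set 'rV[R]_d) (G : 'rV[R]_d -> 'M[R]_d).
Local Notation field := ('rV[R]_d -> R).
Local Notation "'d_ i F" := (pd D (ebase i) F) (at level 10, i at level 8, F at level 8).

Definition gdn (i j : 'I_d) : field := fun x => G x i j.
Definition gup (i j : 'I_d) : field := fun x => invmx (G x) i j.

Definition christoffel (k i j : 'I_d) : field := fun x =>
  2^-1 * \sum_l gup k l x *
    ('d_ i (gdn j l) x + 'd_ j (gdn i l) x - 'd_ l (gdn i j) x).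

Definition nabla1 (T : 'I_d -> field) (k i : 'I_d) : field := fun x =>
  'd_ k (T i) x - \sum_l christoffel l k i x * T l x.

Definition nabla2 (T : 'I_d -> 'I_d -> field) (k i j : 'I_d) : field := fun x =>
  'd_ k (T i j) x
  - \sum_l christoffel l k i x * T l j x
  - \sum_l christoffel l k j x * T i l x.

Definition nabla3 (T : 'I_d -> 'I_d -> 'I_d -> field) (k i j p : 'I_d) : field :=
  fun x =>
  'd_ k (T i j p) x
  - \sum_l christoffel l k i x * T l j p x
  - \sum_l christoffel l k j x * T i l p x
  - \sum_l christoffel l k p x * T i j l x.

Definition nabla4 (T : 'I_d -> 'I_d -> 'I_d -> 'I_d -> field)
    (k i j p q : 'I_d) : field := fun x =>
  'd_ k (T i j p q) x
  - \sum_l christoffel l k i x * T l j p q x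
  - \sum_l christoffel l k j x * T i l p q x
  - \sum_l christoffel l k p x * T i j l q x
  - \sum_l christoffel l k q x * T i j p l x.

(* R^a_{bce}, the a-component of
   (nabla_c nabla_e - nabla_e nabla_c) applied to the b-th coordinate field. *)
Definition riemann_up (a b c e : 'I_d) : field := fun x =>
  'd_ c (christoffel a e b) x - 'd_ e (christoffel a c b) x
  + \sum_l (christoffel a c l x * christoffel l e b x
            - christoffel a e l x * christoffel l c b x).

Definition riemann (a b c e : 'I_d) : field := fun x =>
  \sum_l gdn a l x * riemann_up l b c e x.

Definition ricci (b e : 'I_d) : field := fun x => \sum_a riemann_up a b a e x.

Definition scalar_curv : field := fun x => \sum_i \sum_j gup i j x * ricci i j x.

Definition partial (f : field) (i : 'I_d) : field := fun x => 'd_ i f x.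

Definition grad (f : field) (k : 'I_d) : field := fun x =>
  \sum_l gup k l x * partial f l x.

Definition hess (f : field) : 'I_d -> 'I_d -> field := nabla1 (partial f).

Definition laplacian (f : field) : field := fun x =>
  \sum_i \sum_j gup i j x * hess f i j x.

Definition laplacian2 (T : 'I_d -> 'I_d -> field) (i j : 'I_d) : field := fun x =>
  \sum_k \sum_l gup k l x * nabla3 (nabla2 T) k l i j x.

Definition lie2 (X : 'I_d -> field) (T : 'I_d -> 'I_d -> field)
    (i j : 'I_d) : field := fun x =>
  \sum_k (X k x * 'd_ k (T i j) x
          + T k j x * 'd_ i (X k) x + T i k x * 'd_ j (X k) x).

Definition ginner (u v : 'I_d -> field) : field := fun x =>
  \sum_i \sum_j gdn i j x * u i x * v j x.

Definition raise1 (T : 'I_d -> 'I_d -> field) (k i : 'I_d) : field := fun x =>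
  \sum_p gup k p x * T p i x.

Definition raise2 (T : 'I_d -> 'I_d -> field) (k l : 'I_d) : field := fun x =>
  \sum_p \sum_q gup k p x * gup l q x * T p q x.

End LocalGeometry.

Section BoundaryGeometry.
Context {R : realType} {m : nat}.
Variables (D : set 'rV[R]_m.+1) (G : 'rV[R]_m.+1 -> 'M[R]_m.+1).
Implicit Types (i j k l : 'I_m) (y : 'rV[R]_m) (v : 'rV[R]_m.+1).

Local Notation tg := (lift ord0).

Definition inward_unit_normal (x : 'rV[R]_m.+1) v : Prop :=
  [/\ forall i, \sum_a gdn G a (tg i) x * v 0 a = 0,
      \sum_a \sum_b gdn G a b x * v 0 a * v 0 b = 1 &
      0 < v 0 ord0].

Definition unit_normal (x : 'rV[R]_m.+1) : 'rV[R]_m.+1 :=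
  xget 0 [set v | inward_unit_normal x v].

Definition normal_deriv (f : 'rV[R]_m.+1 -> R) y : R :=
  \sum_a unit_normal (bpt y) 0 a * partial D f a (bpt y).

Definition induced_metric y : 'M[R]_m := \matrix_(i, j) G (bpt y) (tg i) (tg j).

(* A_ij = g(e_0, nabla_{d_i} d_j). *)
Definition sff i j y : R :=
  \sum_a \sum_b gdn G a b (bpt y) * unit_normal (bpt y) 0 a
    * christoffel D G b (tg i) (tg j) (bpt y).

Definition mean_curv y : R := \sum_i \sum_j gup induced_metric i j y * sff i j y.

Definition ricci_tan i j y : R := ricci D G (tg i) (tg j) (bpt y).

Definition riemann_tan i j k l y : R :=
  riemann D G (tg i) (tg j) (tg k) (tg l) (bpt y).

(* R^l_{klj}: the contraction runs over tangential directions only, so the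
   index is raised with the inverse of the induced metric. *)
Definition riemann_tan_trace k j y : R :=
  \sum_l \sum_p gup induced_metric l p y * riemann_tan p k l j y.

(* nabla_0 R_{0i0j} = (nabla_{e_0} Rm)(e_0, d_i, e_0, d_j): e_0 is contracted
   with the components of nabla Rm, it is not differentiated. *)
Definition nabla0_riemann i j y : R :=
  \sum_a \sum_b \sum_c
    unit_normal (bpt y) 0 a * unit_normal (bpt y) 0 b * unit_normal (bpt y) 0 c
    * nabla4 D G (riemann D G) a b (tg i) c (tg j) (bpt y).

Definition nabla0_ricci y : R :=
  \sum_a \sum_b \sum_c
    unit_normal (bpt y) 0 a * unit_normal (bpt y) 0 b * unit_normal (bpt y) 0 c
    * nabla2 D G (ricci D G) a b c (bpt y).

End BoundaryGeometry.

(* Main.v *)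
Require Import Defs.
From HB Require Import structures.
From mathcomp Require Import all_boot all_order all_algebra.
From mathcomp Require Import all_classical all_reals all_analysis.
From mathcomp Require Import ring lra.

Import Order.TTheory GRing.Theory Num.Theory.
Import numFieldNormedType.Exports.

Local Open Scope classical_set_scope.
Local Open Scope ring_scope.

(* Fix a chart.  The smooth functions on (time interval) x (chart range) form a
   commutative ring with commuting derivations, so the computation can be done in
   an arbitrary such ring, and the result evaluated at boundary points afterwards.

   All level sets of the coordinate x^0 are treated at once.  With
   N = (g^00)^(-1/2), the unit normal is nu^a = N g^{a0} and the second fundamental
   form is A_ij = N Gamma^0_ij; Gauss, Weingarten and Codazzi come from splitting
   nabla_i (d_j) along the frame (d_1, ..., d_m, nu).  For dg/dt = h,
     2 dA_ij/dt = h(nu,nu) A_ij + nabla_i h_{j nu} + nabla_j h_{i nu} - nabla_nu h_ij.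
   For h = -2 (Ric + Hess f), commuting nabla_nu past nabla_i turns the terms in f
   into Hess^(nu f), a Lie derivative and curvature, and Simons' identity
   turns Hess^(H) into the Laplacian of A.  What is left over is linear in
   u = H + nu f, in its tangential Hessian, and vanishes on the boundary because
   u = 0 there. *)

Set Implicit Arguments.
Unset Strict Implicit.
Unset Printing Implicit Defensive.

(** * Multilinear forms and derivations *)

Section Multilinear.
Context {A : comPzRingType} {n : nat}.
Implicit Types (u v w z : 'rV[A]_n).

Definition bvec (a : 'I_n) : 'rV[A]_n := delta_mx 0 a.

(* [lin], [bil], [tri], [quad]: the multilinear forms with components [T]. *)
Definition lin (T : 'I_n -> A) u : A := \sum_a T a * u 0 a.
Definition bil (T : 'I_n -> 'I_n -> A) u v : A := lin (fun a => lin (T a) v) u.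
Definition tri (T : 'I_n -> 'I_n -> 'I_n -> A) u v w : A :=
  lin (fun a => bil (T a) v w) u.
Definition quad (T : 'I_n -> 'I_n -> 'I_n -> 'I_n -> A) u v w z : A :=
  lin (fun a => tri (T a) v w z) u.

Lemma eq_lin T T' u : T =1 T' -> lin T u = lin T' u.
Proof. by move=> e; apply: eq_bigr => a _; rewrite e. Qed.

Lemma linD T u v : lin T (u + v) = lin T u + lin T v.
Proof. by rewrite -big_split; apply: eq_bigr => a _; rewrite mxE mulrDr. Qed.

Lemma linZ T c u : lin T (c *: u) = c * lin T u.
Proof. by rewrite mulr_sumr; apply: eq_bigr => a _; rewrite mxE mulrCA. Qed.

Lemma linN T u : lin T (- u) = - lin T u.
Proof. by rewrite -scaleN1r linZ mulN1r. Qed.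

Lemma lin_bvec T a : lin T (bvec a) = T a.
Proof.
rewrite /lin (bigD1 a) //= mxE !eqxx mulr1 big1 ?addr0 // => b /negbTE ab.
by rewrite mxE ab andbF mulr0.
Qed.

Lemma linDl T T' u : lin (fun a => T a + T' a) u = lin T u + lin T' u.
Proof. by rewrite -big_split; apply: eq_bigr => a _; rewrite mulrDl. Qed.

Lemma linZl T c u : lin (fun a => c * T a) u = c * lin T u.
Proof. by rewrite mulr_sumr; apply: eq_bigr => a _; rewrite mulrA. Qed.

Lemma linNl T u : lin (fun a => - T a) u = - lin T u.
Proof. by rewrite -sumrN; apply: eq_bigr => a _; rewrite mulNr. Qed.

Lemma lin_suml (I : finType) (T : I -> 'I_n -> A) u :
  lin (fun a => \sum_i T i a) u = \sum_i lin (T i) u.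
Proof. by rewrite exchange_big; apply: eq_bigr => a _; rewrite mulr_suml. Qed.

Lemma lin_sum (I : finType) T (F : I -> 'rV[A]_n) :
  lin T (\sum_i F i) = \sum_i lin T (F i).
Proof.
rewrite exchange_big; apply: eq_bigr => a _.
by rewrite summxE mulr_sumr.
Qed.

Lemma bvec_sum u : u = \sum_a u 0 a *: bvec a.
Proof.
apply/rowP => b; rewrite summxE (bigD1 b) //= !mxE !eqxx mulr1 big1 ?addr0 //.
by move=> a /negbTE ab; rewrite !mxE eq_sym ab andbF mulr0.
Qed.

Lemma bilC T u v : bil T u v = bil (fun a b => T b a) v u.
Proof.
rewrite /bil /lin; under eq_bigr do rewrite mulr_suml.
rewrite exchange_big; apply: eq_bigr => b _; rewrite mulr_suml.
by apply: eq_bigr => a _; rewrite mulrAC.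
Qed.

Lemma eq_bil T T' u v : (forall a b, T a b = T' a b) -> bil T u v = bil T' u v.
Proof. by move=> e; apply: eq_lin => a; apply: eq_lin. Qed.

Definition bilD1 T v u u' : bil T (u + u') v = bil T u v + bil T u' v := linD _ _ _.
Definition bilZ1 T v c u : bil T (c *: u) v = c * bil T u v := linZ _ _ _.
Definition bilN1 T v u : bil T (- u) v = - bil T u v := linN _ _.
Lemma bilD2 T u v v' : bil T u (v + v') = bil T u v + bil T u v'.
Proof. by rewrite /bil -linDl; apply: eq_lin => a; rewrite linD. Qed.
Lemma bilZ2 T u c v : bil T u (c *: v) = c * bil T u v.
Proof. by rewrite /bil -linZl; apply: eq_lin => a; rewrite linZ. Qed.
Lemma bilN2 T u v : bil T u (- v) = - bil T u v.
Proof. by rewrite -scaleN1r bilZ2 mulN1r. Qed.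
Lemma bil_bvec1 T a v : bil T (bvec a) v = lin (T a) v.
Proof. exact: lin_bvec. Qed.
Lemma bil_bvec T a b : bil T (bvec a) (bvec b) = T a b.
Proof. by rewrite bil_bvec1 lin_bvec. Qed.

Definition triD1 T v w u u' : tri T (u + u') v w = tri T u v w + tri T u' v w :=
  linD _ _ _.
Definition triZ1 T v w c u : tri T (c *: u) v w = c * tri T u v w := linZ _ _ _.
Lemma tri_bvec1 T a v w : tri T (bvec a) v w = bil (T a) v w.
Proof. exact: lin_bvec. Qed.
Lemma triD2 T u v v' w : tri T u (v + v') w = tri T u v w + tri T u v' w.
Proof. by rewrite /tri -linDl; apply: eq_lin => a; rewrite bilD1. Qed.
Lemma triZ2 T u c v w : tri T u (c *: v) w = c * tri T u v w.
Proof. by rewrite /tri -linZl; apply: eq_lin => a; rewrite bilZ1. Qed.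
Lemma triD3 T u v w w' : tri T u v (w + w') = tri T u v w + tri T u v w'.
Proof. by rewrite /tri -linDl; apply: eq_lin => a; rewrite bilD2. Qed.
Lemma triZ3 T u v c w : tri T u v (c *: w) = c * tri T u v w.
Proof. by rewrite /tri -linZl; apply: eq_lin => a; rewrite bilZ2. Qed.

Definition quadD1 T v w z u u' :
  quad T (u + u') v w z = quad T u v w z + quad T u' v w z := linD _ _ _.
Definition quadZ1 T v w z c u : quad T (c *: u) v w z = c * quad T u v w z :=
  linZ _ _ _.
Definition quadN1 T v w z u : quad T (- u) v w z = - quad T u v w z := linN _ _.
Lemma quad_bvec1 T a v w z : quad T (bvec a) v w z = tri (T a) v w z.
Proof. exact: lin_bvec. Qed.
Lemma quadD2 T u v v' w z :
  quad T u (v + v') w z = quad T u v w z + quad T u v' w z.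
Proof. by rewrite /quad -linDl; apply: eq_lin => a; rewrite triD1. Qed.
Lemma quadZ2 T u c v w z : quad T u (c *: v) w z = c * quad T u v w z.
Proof. by rewrite /quad -linZl; apply: eq_lin => a; rewrite triZ1. Qed.
Lemma quadD3 T u v w w' z :
  quad T u v (w + w') z = quad T u v w z + quad T u v w' z.
Proof. by rewrite /quad -linDl; apply: eq_lin => a; rewrite triD2. Qed.
Lemma quadZ3 T u v c w z : quad T u v (c *: w) z = c * quad T u v w z.
Proof. by rewrite /quad -linZl; apply: eq_lin => a; rewrite triZ2. Qed.
Lemma quadD4 T u v w z z' :
  quad T u v w (z + z') = quad T u v w z + quad T u v w z'.
Proof. by rewrite /quad -linDl; apply: eq_lin => a; rewrite triD3. Qed.
Lemma quadZ4 T u v w c z : quad T u v w (c *: z) = c * quad T u v w z.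
Proof. by rewrite /quad -linZl; apply: eq_lin => a; rewrite triZ3. Qed.
Lemma quad_bvec T a b c e :
  quad T (bvec a) (bvec b) (bvec c) (bvec e) = T a b c e.
Proof. by rewrite quad_bvec1 tri_bvec1 bil_bvec. Qed.

Lemma quad_lin3 T u v w z : quad T u v w z = lin (fun a => quad T u v (bvec a) z) w.
Proof.
have q0 : quad T u v 0 z = 0 by rewrite -(scale0r 0) quadZ3 mul0r.
rewrite {1}[w]bvec_sum (big_morph _ (fun x y => quadD3 T u v x y z) q0).
by apply: eq_bigr => a _; rewrite quadZ3 mulrC.
Qed.

Lemma bil_quad T u v p q :
  bil (fun b e => bil (fun c a => T c b a e) p q) u v = quad T p u q v.
Proof.
rewrite /quad /tri.
transitivity (lin (fun b => lin (fun c => bil (fun a e => T c b a e) q v) p) u).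
  apply: eq_lin => b; rewrite -[RHS]/(bil _ _ _); 
  rewrite -[LHS]/(bil (fun e c => lin (fun a => T c b a e) q) v p) bilC.
  by apply: eq_lin => c; rewrite [RHS]bilC.
exact: bilC.
Qed.

Lemma bil_sum1 (I : finType) T (F : I -> 'rV[A]_n) v :
  bil T (\sum_i F i) v = \sum_i bil T (F i) v.
Proof. exact: lin_sum. Qed.

Lemma bil_sum2 (I : finType) T (F : I -> 'rV[A]_n) v :
  bil T v (\sum_i F i) = \sum_i bil T v (F i).
Proof. by rewrite bilC bil_sum1; apply: eq_bigr => i _; rewrite bilC. Qed.

Lemma bilDl T T' u v : bil (fun a b => T a b + T' a b) u v = bil T u v + bil T' u v.
Proof. by rewrite /bil -linDl; apply: eq_lin => a; rewrite linDl. Qed.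

Lemma bilZl T c u v : bil (fun a b => c * T a b) u v = c * bil T u v.
Proof. by rewrite /bil -linZl; apply: eq_lin => a; rewrite linZl. Qed.

Lemma bil_suml (I : finType) (T : I -> 'I_n -> 'I_n -> A) u v :
  bil (fun a b => \sum_i T i a b) u v = \sum_i bil (T i) u v.
Proof. by rewrite /bil -lin_suml; apply: eq_lin => a; rewrite lin_suml. Qed.

Lemma triE T u v w : tri T u v w =
  \sum_a \sum_b \sum_c u 0 a * v 0 b * w 0 c * T a b c.
Proof.
apply: eq_bigr => a _; rewrite /bil /lin mulr_suml; apply: eq_bigr => b _.
rewrite !mulr_suml; apply: eq_bigr => c _.
ring.
Qed.

Lemma tri_swap12 T u v w : tri T u v w = tri (fun a b c => T b a c) v u w.
Proof. exact: bilC. Qed.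

Lemma tri_swap23 T u v w : tri T u v w = tri (fun a b c => T a c b) u w v.
Proof. by apply: eq_lin => a; rewrite bilC. Qed.

Lemma quad_swap34 T u v w z : quad T u v w z = quad (fun a b c e => T a b e c) u v z w.
Proof. by apply: eq_lin => a; apply: eq_lin => b; rewrite bilC. Qed.

Lemma quad_swap23 T u v w z : quad T u v w z = quad (fun a b c e => T a c b e) u w v z.
Proof. by apply: eq_lin => a; rewrite /tri [LHS]bilC. Qed.

Lemma quad_swap12 T u v w z : quad T u v w z = quad (fun a b c e => T b a c e) v u w z.
Proof. exact: bilC. Qed.

Lemma quad_pair T u v w z : quad T u v w z = quad (fun a b c e => T c e a b) w z u v.
Proof. by rewrite quad_swap23 quad_swap12 quad_swap34 quad_swap23. Qed.

Lemma quad_lin4 T u v w z : quad T u v w z = lin (fun a => quad T u v w (bvec a)) z.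
Proof. by rewrite quad_swap34 quad_lin3; apply: eq_lin => a; rewrite quad_swap34. Qed.

Lemma quad_lin2 T u v w z : quad T u v w z = lin (fun a => quad T u (bvec a) w z) v.
Proof. by rewrite quad_swap12; apply: eq_lin => a; rewrite quad_swap12 quad_bvec1. Qed.

Lemma eq_quad T T' u v w z : (forall a b c e, T a b c e = T' a b c e) ->
  quad T u v w z = quad T' u v w z.
Proof. by move=> e; apply: eq_lin => a; apply: eq_lin => b; apply: eq_bil => c f. Qed.

Lemma quadNl T u v w z : quad (fun a b c e => - T a b c e) u v w z = - quad T u v w z.
Proof.
rewrite /quad -linNl; apply: eq_lin => a; rewrite /tri -linNl; apply: eq_lin => b.
by rewrite /bil -linNl; apply: eq_lin => c; rewrite linNl.
Qed.

End Multilinear.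

Lemma eq_of_sub (V : zmodType) (x y u v : V) : u = v -> x - y = u - v -> x = y.
Proof. by move=> ->; rewrite subrr => /eqP; rewrite subr_eq0 => /eqP. Qed.

Section Derivation.
Context {A : comPzRingType}.

Definition derivation (D : A -> A) : Prop :=
  (forall a b, D (a + b) = D a + D b) /\ (forall a b, D (a * b) = D a * b + a * D b).

Variables (D : A -> A) (derD : derivation D).

Lemma derD_ a b : D (a + b) = D a + D b. Proof. exact: derD.1. Qed.
Lemma derM a b : D (a * b) = D a * b + a * D b. Proof. exact: derD.2. Qed.
Lemma der0 : D 0 = 0.
Proof. by apply: (@addrI _ (D 0)); rewrite -derD_ !addr0. Qed.
Lemma derN a : D (- a) = - D a.
Proof. by apply/eqP; rewrite -addr_eq0 -derD_ addNr der0. Qed.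
Lemma derB a b : D (a - b) = D a - D b. Proof. by rewrite derD_ derN. Qed.
Lemma der1 : D 1 = 0.
Proof. by apply: (@addrI _ (D 1)); rewrite addr0 -{3}[1]mulr1 derM mulr1 mul1r. Qed.
Lemma der_sum (I : finType) (F : I -> A) : D (\sum_i F i) = \sum_i D (F i).
Proof. exact: (big_morph D derD_ der0). Qed.
Lemma der_bool (b : bool) : D b%:R = 0.
Proof. by case: b; rewrite ?der1 ?der0. Qed.
Lemma der_half (h : A) : h * 2 = 1 -> D h = 0.
Proof.
move=> h2; have : D (h * 2) = 0 by rewrite h2 der1.
rewrite derM derD_ der1 addr0 mulr0 addr0 => e.
by rewrite -[LHS]mulr1 -h2 mulrCA e mulr0.
Qed.
End Derivation.

(** * Riemannian geometry over a ring with commuting derivations *)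

(* A metric [ag_g] with inverse [ag_gi] over a ring of functions [A] with commuting
   coordinate derivations [ag_d]; [achr], [anab1], ... are the formulas of Defs.v with
   [ag_d] in place of [pd]. *)
Record ageom (A : comPzRingType) (n : nat) := AGeom {
  ag_half : A;
  ag_d : 'I_n -> A -> A;
  ag_g : 'I_n -> 'I_n -> A;
  ag_gi : 'I_n -> 'I_n -> A;
  ag_half2 : ag_half * 2 = 1;
  ag_der : forall a, derivation (ag_d a);
  ag_dC : forall a b x, ag_d a (ag_d b x) = ag_d b (ag_d a x);
  ag_gC : forall a b, ag_g a b = ag_g b a;
  ag_gi_g : forall a b, \sum_l ag_gi a l * ag_g l b = (a == b)%:R }.

Section AlgebraicGeometry.
Context {A : comPzRingType} {n : nat}.
Variable G : ageom A n.
Local Notation half := (ag_half G).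
Local Notation d := (ag_d G).
Local Notation g := (ag_g G).
Local Notation gi := (ag_gi G).

Definition achr (k i j : 'I_n) : A :=
  half * \sum_l gi k l * (d i (g j l) + d j (g i l) - d l (g i j)).

Definition anab1 (T : 'I_n -> A) (k i : 'I_n) : A :=
  d k (T i) - \sum_l achr l k i * T l.

Definition anab2 (T : 'I_n -> 'I_n -> A) (k i j : 'I_n) : A :=
  d k (T i j) - \sum_l achr l k i * T l j - \sum_l achr l k j * T i l.

Definition anab3 (T : 'I_n -> 'I_n -> 'I_n -> A) (k i j p : 'I_n) : A :=
  d k (T i j p) - \sum_l achr l k i * T l j p - \sum_l achr l k j * T i l p
  - \sum_l achr l k p * T i j l.

Definition anab4 (T : 'I_n -> 'I_n -> 'I_n -> 'I_n -> A) (k i j p q : 'I_n) : A :=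
  d k (T i j p q) - \sum_l achr l k i * T l j p q - \sum_l achr l k j * T i l p q
  - \sum_l achr l k p * T i j l q - \sum_l achr l k q * T i j p l.

Definition ariem_up (a b c e : 'I_n) : A :=
  d c (achr a e b) - d e (achr a c b)
  + \sum_l (achr a c l * achr l e b - achr a e l * achr l c b).

Definition ariem (a b c e : 'I_n) : A := \sum_l g a l * ariem_up l b c e.

Definition aricci (b e : 'I_n) : A := \sum_a ariem_up a b a e.

Definition apart (f : A) (i : 'I_n) : A := d i f.

Definition agrad (f : A) (k : 'I_n) : A := \sum_l gi k l * apart f l.

Definition ahess (f : A) : 'I_n -> 'I_n -> A := anab1 (apart f).

Definition atrace (T : 'I_n -> 'I_n -> A) : A := \sum_i \sum_j gi i j * T i j.

Definition alapl2 (T : 'I_n -> 'I_n -> A) (i j : 'I_n) : A :=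
  \sum_k \sum_l gi k l * anab3 (anab2 T) k l i j.

Definition alie2 (X : 'I_n -> A) (T : 'I_n -> 'I_n -> A) (i j : 'I_n) : A :=
  \sum_k (X k * d k (T i j) + T k j * d i (X k) + T i k * d j (X k)).

Definition araise1 (T : 'I_n -> 'I_n -> A) (k i : 'I_n) : A :=
  \sum_p gi k p * T p i.

Definition araise2 (T : 'I_n -> 'I_n -> A) (k l : 'I_n) : A :=
  \sum_p \sum_q gi k p * gi l q * T p q.

(* [cov k v] is nabla_k v for a vector field v = (v^c). *)
Definition cov (k : 'I_n) (v : 'rV[A]_n) : 'rV[A]_n :=
  \row_c (d k (v 0 c) + \sum_b achr c k b * v 0 b).

Definition curv (c e : 'I_n) (v : 'rV[A]_n) : 'rV[A]_n :=
  cov c (cov e v) - cov e (cov c v).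

Definition ip : 'rV[A]_n -> 'rV[A]_n -> A := bil g.

Let half2 : half * 2 = 1 := ag_half2 G.
Let der : forall a, derivation (d a) := ag_der G.
Let dC : forall a b x, d a (d b x) = d b (d a x) := @ag_dC _ _ G.
Let g_sym : forall a b, g a b = g b a := @ag_gC _ _ G.
Let gi_g : forall a b, \sum_l gi a l * g l b = (a == b)%:R := @ag_gi_g _ _ G.

Let e_ := @bvec A n.
Let dD k := derD_ (der k).
Let dM k := derM (der k).
Let dN k := derN (der k).
Let d1 k := der1 (der k).
Let d_bool k := der_bool (der k).
Let d_sum k := der_sum (der k).

Lemma chr_sym k i j : achr k i j = achr k j i.
Proof.
congr (_ * _); apply: eq_bigr => l _.
by rewrite (g_sym i j) [d i _ + _]addrC.
Qed.

Lemma covD k u v : cov k (u + v) = cov k u + cov k v.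
Proof.
apply/rowP => c; rewrite !mxE dD [RHS]addrACA -big_split /=.
by congr (_ + _); apply: eq_bigr => b _; rewrite mxE mulrDr.
Qed.

Lemma covZ k a v : cov k (a *: v) = d k a *: v + a *: cov k v.
Proof.
apply/rowP => c; rewrite !mxE dM mulrDr addrA mulr_sumr.
by congr (_ + _); apply: eq_bigr => b _; rewrite mxE mulrCA.
Qed.

Lemma covN k v : cov k (- v) = - cov k v.
Proof.
rewrite -scaleN1r covZ dN d1 oppr0 scale0r add0r.
by rewrite scaleN1r.
Qed.

Lemma covB k u v : cov k (u - v) = cov k u - cov k v.
Proof. by rewrite covD covN. Qed.

Lemma cov_bvec k b : cov k (e_ b) = \row_c achr c k b.
Proof.
apply/rowP => c; rewrite !mxE d_bool add0r.
by rewrite -[RHS](lin_bvec (achr c k)).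
Qed.

Lemma torsion_free a b : cov a (e_ b) = cov b (e_ a).
Proof. by rewrite !cov_bvec; apply/rowP => c; rewrite !mxE chr_sym. Qed.

Lemma lin_cov_bvec T k b : lin T (cov k (e_ b)) = \sum_l achr l k b * T l.
Proof. by rewrite cov_bvec; apply: eq_bigr => l _; rewrite mxE mulrC. Qed.

Lemma d_lin k T u : d k (lin T u) = lin (anab1 T k) u + lin T (cov k u).
Proof.
rewrite /lin d_sum.
under eq_bigr do rewrite dM.
under [X in _ = X + _]eq_bigr do rewrite mulrBl.
under [X in _ = _ + X]eq_bigr do rewrite mxE mulrDr.
rewrite !big_split /= sumrN.
have -> : \sum_i (\sum_l achr l k i * T l) * u 0 i
        = \sum_i T i * \sum_b achr i k b * u 0 b.
  under eq_bigr do rewrite mulr_suml.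
  rewrite exchange_big; apply: eq_bigr => i _; rewrite mulr_sumr.
  by apply: eq_bigr => b _; rewrite mulrA [T i * _]mulrC.
ring.
Qed.

Lemma d_bil k T u v :
  d k (bil T u v) = bil (anab2 T k) u v + bil T (cov k u) v + bil T u (cov k v).
Proof.
rewrite /bil d_lin addrAC; congr (_ + _); rewrite -linDl; apply: eq_lin => a.
rewrite /anab1 d_lin addrAC; congr (_ + _).
under eq_bigr => l _ do rewrite -linZl.
rewrite -lin_suml -linNl -linDl; apply: eq_lin => b.
by rewrite /anab1 /anab2 addrAC.
Qed.

Lemma d_tri k T u v w :
  d k (tri T u v w) = tri (anab3 T k) u v w + tri T (cov k u) v w
    + tri T u (cov k v) w + tri T u v (cov k w).
Proof.
rewrite /tri d_lin.
suff -> : lin (anab1 (fun a => bil (T a) v w) k) u =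
    lin (fun a => bil (anab3 T k a) v w) u
    + lin (fun a => bil (T a) (cov k v) w) u
    + lin (fun a => bil (T a) v (cov k w)) u by ring.
rewrite -!linDl; apply: eq_lin => a; rewrite /anab1 d_bil.
suff -> : bil (anab3 T k a) v w
    = bil (anab2 (T a) k) v w - \sum_l achr l k a * bil (T l) v w by ring.
under eq_bigr => l _ do rewrite /bil -linZl.
rewrite -lin_suml -linNl -linDl; apply: eq_lin => b.
under eq_bigr => l _ do rewrite -linZl.
rewrite -lin_suml -linNl -linDl; apply: eq_lin => c.
by rewrite /anab3 /anab2; ring.
Qed.

Lemma d_quad k T u v w z :
  d k (quad T u v w z) = quad (anab4 T k) u v w z + quad T (cov k u) v w z
    + quad T u (cov k v) w z + quad T u v (cov k w) z + quad T u v w (cov k z).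
Proof.
rewrite /quad d_lin.
suff -> : lin (anab1 (fun a => tri (T a) v w z) k) u =
    lin (fun a => tri (anab4 T k a) v w z) u
    + lin (fun a => tri (T a) (cov k v) w z) u
    + lin (fun a => tri (T a) v (cov k w) z) u
    + lin (fun a => tri (T a) v w (cov k z)) u by ring.
rewrite -!linDl; apply: eq_lin => a; rewrite /anab1 d_tri.
suff -> : tri (anab4 T k a) v w z
    = tri (anab3 (T a) k) v w z - \sum_l achr l k a * tri (T l) v w z by ring.
under eq_bigr => l _ do rewrite /tri -linZl.
rewrite -lin_suml -linNl -linDl; apply: eq_lin => b.
under eq_bigr => l _ do rewrite /bil -linZl.
rewrite -lin_suml -linNl -linDl; apply: eq_lin => c.
under eq_bigr => l _ do rewrite -linZl.
rewrite -lin_suml -linNl -linDl; apply: eq_lin => e.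
by rewrite /anab3 /anab4; ring.
Qed.

Lemma ipC u v : ip u v = ip v u.
Proof. by rewrite /ip bilC; apply: eq_bil. Qed.

Lemma half_cancel (a b : A) : a * 2 = b * 2 -> a = b.
Proof. by move=> e; rewrite -[a]mulr1 -[b]mulr1 -half2 ![half * _]mulrC !mulrA e. Qed.

Lemma gi_trans a b : gi b a = gi a b.
Proof.
pose X : 'M[A]_n := \matrix_(a, b) gi a b; pose Y : 'M[A]_n := \matrix_(a, b) g a b.
have XY : X *m Y = 1%:M.
  apply/matrixP => i j; rewrite !mxE -gi_g; apply: eq_bigr => l _.
  by rewrite !mxE.
have YX := mulmx1C XY.
have XtY : Y *m X^T = 1%:M.
  have -> : Y = Y^T by apply/matrixP => i j; rewrite !mxE.
  by rewrite -trmx_mul XY trmx1.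
have : X = X^T by rewrite -[LHS]mulmx1 -XtY mulmxA XY mul1mx.
by move/matrixP => /(_ b a); rewrite !mxE.
Qed.

Lemma g_gi a b : \sum_l g a l * gi l b = (a == b)%:R.
Proof.
rewrite eq_sym -gi_g; apply: eq_bigr => l _.
by rewrite mulrC (g_sym a) gi_trans.
Qed.

Lemma chr_low a b c : ip (cov a (e_ b)) (e_ c) =
  half * (d a (g b c) + d b (g a c) - d c (g a b)).
Proof.
rewrite ipC /ip bil_bvec1 lin_cov_bvec /achr.
pose z l := d a (g b l) + d b (g a l) - d l (g a b).
under eq_bigr => l _ do rewrite -mulrA -/z.
rewrite -mulr_sumr; congr (_ * _).
rewrite -[RHS]/(z c).
have -> : z c = \sum_p z p * (c == p)%:R.
  by rewrite -[LHS](lin_bvec z); apply: eq_bigr => p _; rewrite mxE eqxx eq_sym.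
under [RHS]eq_bigr => p _ do rewrite -g_gi mulr_sumr.
rewrite [RHS]exchange_big; apply: eq_bigr => l _; rewrite mulr_suml.
by apply: eq_bigr => p _; rewrite [X in X * g c l]mulrC -mulrA [gi l p * _]mulrC.
Qed.

Lemma anab2_g k i j : anab2 g k i j = 0.
Proof.
rewrite /anab2.
have -> : \sum_l achr l k i * g l j = ip (cov k (e_ i)) (e_ j).
  by rewrite /ip bilC bil_bvec1 lin_cov_bvec.
have -> : \sum_l achr l k j * g i l = ip (cov k (e_ j)) (e_ i).
  rewrite ipC /ip bil_bvec1 lin_cov_bvec.
  by [].
rewrite !chr_low (g_sym j i).
transitivity ((1 - half * 2) * d k (g i j)); first by ring.
by rewrite half2 subrr mul0r.
Qed.

Lemma d_ip k u v : d k (ip u v) = ip (cov k u) v + ip u (cov k v).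
Proof.
rewrite /ip d_bil -addrA -[RHS]add0r; congr (_ + _).
rewrite (@eq_bil _ _ _ (fun _ _ => 0)); last exact: anab2_g.
by rewrite /bil /lin big1 // => a _; rewrite big1 ?mul0r // => b _; rewrite mul0r.
Qed.

Lemma ip_nondeg v : (forall b, ip v (e_ b) = 0) -> v = 0.
Proof.
move=> v0; apply/rowP => c; rewrite mxE.
rewrite -[LHS](lin_bvec (fun a => v 0 a)) /lin.
under eq_bigr => a _ do rewrite mxE eqxx [_ == c]eq_sym -gi_g mulr_sumr.
rewrite exchange_big big1 // => l _.
transitivity (gi c l * ip v (e_ l)); last by rewrite v0 mulr0.
rewrite ipC /ip bil_bvec1 mulr_sumr; apply: eq_bigr => a _.
by rewrite mulrCA [v 0 a * _]mulrC.
Qed.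

Lemma curvD c e u v : curv c e (u + v) = curv c e u + curv c e v.
Proof. by rewrite /curv !covD opprD addrACA. Qed.

Lemma curvZ c e a v : curv c e (a *: v) = a *: curv c e v.
Proof.
rewrite /curv !(covZ, covD) (dC c e a).
move: (cov c (cov e v)) (cov e (cov c v)) (cov e v) (cov c v) => w1 w2 w3 w4.
by apply/rowP => i; rewrite !mxE; ring.
Qed.

Lemma curv_skew c e v : curv c e v = - curv e c v.
Proof. by rewrite opprB. Qed.

Lemma curv_sum (I : finType) c e (F : I -> 'rV[A]_n) :
  curv c e (\sum_i F i) = \sum_i curv c e (F i).
Proof.
have c0 : curv c e 0 = 0 by rewrite -(scale0r 0) curvZ !scale0r.
exact: (big_morph (curv c e) (curvD c e) c0).
Qed.

Lemma curv_bvec c e b : curv c e (e_ b) = \row_a ariem_up a b c e.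
Proof.
rewrite /curv !cov_bvec; apply/rowP => a; rewrite !mxE.
under eq_bigr do rewrite mxE.
under [X in _ - (_ + X)]eq_bigr do rewrite mxE.
by rewrite /ariem_up sumrB; ring.
Qed.

Lemma ip_curv u v c e : ip u (curv c e v) = quad ariem u v (e_ c) (e_ e).
Proof.
rewrite /quad /ip /bil; apply: eq_lin => a.
rewrite {1}[v]bvec_sum curv_sum lin_sum /tri; apply: eq_bigr => b _.
rewrite curvZ linZ mulrC bil_bvec; congr (_ * _).
by rewrite curv_bvec; apply: eq_bigr => l _; rewrite mxE.
Qed.

Lemma ariemE a b c e : ariem a b c e = ip (e_ a) (curv c e (e_ b)).
Proof. by rewrite ip_curv quad_bvec. Qed.

Lemma ipD1 u u' v : ip (u + u') v = ip u v + ip u' v. Proof. exact: bilD1. Qed.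
Lemma ipD2 u v v' : ip u (v + v') = ip u v + ip u v'. Proof. exact: bilD2. Qed.
Lemma ipN1 u v : ip (- u) v = - ip u v. Proof. exact: bilN1. Qed.
Lemma ipN2 u v : ip u (- v) = - ip u v. Proof. exact: bilN2. Qed.
Lemma ipZ1 a u v : ip (a *: u) v = a * ip u v. Proof. exact: bilZ1. Qed.
Lemma ipZ2 a u v : ip u (a *: v) = a * ip u v. Proof. exact: bilZ2. Qed.

Lemma ip_curv_skew u v c e : ip u (curv c e v) = - ip v (curv c e u).
Proof.
apply/eqP; rewrite -addr_eq0; apply/eqP.
have := dC c e (ip u v); rewrite !(d_ip, dD) => H.
rewrite [ip v _]ipC /curv ipD1 ipD2 ipN1 ipN2.
transitivity (ip (cov c (cov e u)) v + ip (cov e u) (cov c v)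
   + (ip (cov c u) (cov e v) + ip u (cov c (cov e v)))
   - (ip (cov e (cov c u)) v + ip (cov c u) (cov e v) +
    (ip (cov e u) (cov c v) + ip u (cov e (cov c v))))); first by ring.
by rewrite H subrr.
Qed.

Lemma bianchi1 a b c : curv a b (e_ c) + curv b c (e_ a) + curv c a (e_ b) = 0.
Proof.
rewrite /curv (torsion_free b c) (torsion_free c a) (torsion_free a b).
by apply/rowP => i; rewrite !mxE; ring.
Qed.

Lemma riem_skew12 a b c e : ariem a b c e = - ariem b a c e.
Proof. by rewrite !ariemE ip_curv_skew. Qed.

Lemma riem_skew34 a b c e : ariem a b c e = - ariem a b e c.
Proof. by rewrite !ariemE curv_skew ipN2. Qed.

Lemma riem_bianchi1 a b c e : ariem a b c e + ariem a c e b + ariem a e b c = 0.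
Proof.
rewrite !ariemE -!ipD2.
rewrite [X in ip _ X](_ : _ = 0); last by rewrite addrAC -[RHS](bianchi1 c e b) addrAC.
by rewrite -(scale0r 0) ipZ2 mul0r.
Qed.

(* The four instances of the first Bianchi identity, each omitting one index in turn,
   combine to twice the claim. *)
Lemma riem_pair a b c e : ariem a b c e = ariem c e a b.
Proof.
apply: half_cancel; apply/eqP; rewrite -subr_eq0; apply/eqP.
have Ba := riem_bianchi1 a b c e; have Bb := riem_bianchi1 b a c e.
have Bc := riem_bianchi1 c e a b; have Be := riem_bianchi1 e c a b.
rewrite (riem_skew12 b a) (riem_skew34 b c) (riem_skew12 b e) in Bb.
rewrite (riem_skew12 c a) (riem_skew34 a c b) (riem_skew12 c b) (riem_skew34 b c e) !opprK in Bc.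
rewrite (riem_skew12 e c) (riem_skew12 e a) (riem_skew34 e b) in Be.
have -> : ariem a b c e * 2 - ariem c e a b * 2
  = (ariem a b c e + ariem a c e b + ariem a e b c)
    - (- ariem a b c e - ariem b c a e - ariem e b a c)
    - (ariem c e a b + ariem a c e b + ariem b c a e)
    + (- ariem c e a b - ariem a e b c - ariem e b a c) by ring.
by rewrite Ba Bb Bc Be !subr0 addr0.
Qed.

Lemma anab4_riem k a b c e : anab4 ariem k a b c e =
  ip (e_ a) (cov k (curv c e (e_ b))) - ip (e_ a) (curv c e (cov k (e_ b)))
  - quad ariem (e_ a) (e_ b) (cov k (e_ c)) (e_ e)
  - quad ariem (e_ a) (e_ b) (e_ c) (cov k (e_ e)).
Proof.
have := d_quad k ariem (e_ a) (e_ b) (e_ c) (e_ e).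
rewrite -!ip_curv d_ip quad_bvec => H.
by apply: (eq_of_sub (esym H)); ring.
Qed.

Lemma riem_bianchi2 k a b c e :
  anab4 ariem k a b c e + anab4 ariem c a b e k + anab4 ariem e a b k c = 0.
Proof.
rewrite !anab4_riem (torsion_free e k) (torsion_free c k) (torsion_free e c).
have sk u v w z : quad ariem u v w z = - quad ariem u v z w.
  rewrite /quad -linNl; apply: eq_lin => p; rewrite /tri -linNl; apply: eq_lin => q.
  by rewrite bilC /bil -linNl; apply: eq_lin => r; rewrite -linNl;
     apply: eq_lin => s; rewrite riem_skew34.
rewrite [quad ariem _ _ (cov k (e_ e)) _]sk [quad ariem _ _ (cov c (e_ e)) _]sk.
rewrite [quad ariem _ _ (cov k (e_ c)) _]sk.
rewrite /curv !(ipD2, ipN2, covB); ring.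
Qed.

Lemma anab4_pair k a b c e : anab4 ariem k a b c e = anab4 ariem k c e a b.
Proof.
rewrite /anab4 riem_pair.
under eq_bigr do rewrite riem_pair.
under [X in _ - _ - X - _ - _ = _]eq_bigr do rewrite riem_pair.
under [X in _ - _ - _ - X - _ = _]eq_bigr do rewrite riem_pair.
under [X in _ - _ - _ - _ - X = _]eq_bigr do rewrite riem_pair.
ring.
Qed.

Lemma anab4_skew34 k a b c e : anab4 ariem k a b c e = - anab4 ariem k a b e c.
Proof.
rewrite /anab4 riem_skew34 dN.
under eq_bigr do rewrite riem_skew34 mulrN.
under [X in _ - _ - X - _ - _ = _]eq_bigr do rewrite riem_skew34 mulrN.
under [X in _ - _ - _ - X - _ = _]eq_bigr do rewrite riem_skew34 mulrN.
under [X in _ - _ - _ - _ - X = _]eq_bigr do rewrite riem_skew34 mulrN.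
rewrite !sumrN; ring.
Qed.

Lemma ricci_id1 T k l i :
  anab2 (anab1 T) k l i - anab2 (anab1 T) l k i = - lin T (curv k l (e_ i)).
Proof.
have E a b : d a (d b (lin T (e_ i))) = anab2 (anab1 T) a b i
    + bil (anab1 T) (cov a (e_ b)) (e_ i) + lin (anab1 T b) (cov a (e_ i))
    + lin (anab1 T a) (cov b (e_ i)) + lin T (cov a (cov b (e_ i))).
  rewrite d_lin -bil_bvec1 dD d_bil d_lin bil_bvec bil_bvec1.
  ring.
have := dC k l (lin T (e_ i)); rewrite !E (torsion_free l k) => H.
by apply: (eq_of_sub H); rewrite /curv linD linN; ring.
Qed.

Lemma ricci_id2 T k l i j :
  anab3 (anab2 T) k l i j - anab3 (anab2 T) l k i j =
  - bil T (curv k l (e_ i)) (e_ j) - bil T (e_ i) (curv k l (e_ j)).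
Proof.
have E a b : d a (d b (bil T (e_ i) (e_ j))) = anab3 (anab2 T) a b i j
    + tri (anab2 T) (cov a (e_ b)) (e_ i) (e_ j)
    + bil (anab2 T b) (cov a (e_ i)) (e_ j) + bil (anab2 T b) (e_ i) (cov a (e_ j))
    + bil (anab2 T a) (cov b (e_ i)) (e_ j) + bil (anab2 T a) (e_ i) (cov b (e_ j))
    + bil T (cov a (cov b (e_ i))) (e_ j) + bil T (e_ i) (cov a (cov b (e_ j)))
    + bil T (cov a (e_ i)) (cov b (e_ j)) + bil T (cov b (e_ i)) (cov a (e_ j)).
  rewrite d_bil -tri_bvec1 !dD d_tri !d_bil tri_bvec1 bil_bvec !tri_bvec1.
  ring.
have := dC k l (bil T (e_ i) (e_ j)); rewrite !E (torsion_free l k) => H.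
by apply: (eq_of_sub H); rewrite /curv bilD1 bilN1 bilD2 bilN2; ring.
Qed.

Definition dual (a : 'I_n) : 'rV[A]_n := \row_b gi a b.

Lemma ip_dual a b : ip (dual a) (e_ b) = (a == b)%:R.
Proof.
rewrite ipC /ip bil_bvec1 -gi_g; apply: eq_bigr => l _.
by rewrite mxE mulrC g_sym.
Qed.

Lemma lin_dual T a : lin T (dual a) = \sum_b gi a b * T b.
Proof. by apply: eq_bigr => b _; rewrite mxE mulrC. Qed.

Lemma ip_inj u v : (forall b, ip u (e_ b) = ip v (e_ b)) -> u = v.
Proof.
move=> uv; apply/eqP; rewrite -subr_eq0; apply/eqP/ip_nondeg => b.
by rewrite ipD1 ipN1 uv subrr.
Qed.

Lemma sum_delta (T : 'I_n -> A) c : \sum_b T b * (b == c)%:R = T c.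
Proof.
by rewrite -[RHS](lin_bvec T); apply: eq_bigr => b _; rewrite mxE eqxx.
Qed.

Lemma ip_suml (I : finType) (F : I -> 'rV[A]_n) v :
  ip (\sum_i F i) v = \sum_i ip (F i) v.
Proof. exact: lin_sum. Qed.

Lemma ip_sumr (I : finType) (F : I -> 'rV[A]_n) v :
  ip v (\sum_i F i) = \sum_i ip v (F i).
Proof. by rewrite ipC ip_suml; apply: eq_bigr => i _; rewrite ipC. Qed.

Lemma ip_dualE a v : ip (dual a) v = v 0 a.
Proof.
rewrite {1}[v]bvec_sum ip_sumr -[RHS](sum_delta (v 0)); apply: eq_bigr => b _.
by rewrite ipZ2 ip_dual eq_sym.
Qed.

Lemma cov_dual k a : cov k (dual a) = - \sum_b achr a k b *: dual b.
Proof.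
apply: ip_inj => c; have := d_ip k (dual a) (e_ c).
rewrite ip_dual d_bool => /esym/eqP; rewrite addr_eq0 => /eqP ->.
rewrite ipN1 ip_dualE ip_suml cov_bvec mxE; congr (- _).
by under eq_bigr do rewrite ipZ1 ip_dual; rewrite sum_delta.
Qed.

Lemma atrace_bil T : atrace T = \sum_a bil T (e_ a) (dual a).
Proof. by apply: eq_bigr => a _; rewrite bil_bvec1 lin_dual. Qed.

Lemma d_trace k T : d k (atrace T) = atrace (anab2 T k).
Proof.
rewrite !atrace_bil d_sum.
under eq_bigr do rewrite d_bil cov_dual [cov _ _]bvec_sum cov_bvec bilN2 bil_sum1 bil_sum2.
rewrite sumrB big_split /=.
under [X in _ + X - _]eq_bigr do under eq_bigr do rewrite mxE bilZ1.
under [X in _ - X]eq_bigr do under eq_bigr do rewrite bilZ2.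
by rewrite [X in _ - X]exchange_big addrK.
Qed.

Lemma aricci_trace b e : aricci b e = atrace (fun c a => ariem c b a e).
Proof.
rewrite /atrace exchange_big; apply: eq_bigr => /= a _.
rewrite -[LHS](sum_delta (fun l => ariem_up l b a e)).
under [LHS]eq_bigr => l _ do rewrite -(g_gi l) mulr_sumr.
rewrite exchange_big; apply: eq_bigr => c _; rewrite mulr_sumr.
by apply: eq_bigr => l _; rewrite (g_sym c); ring.
Qed.

Lemma eq_atrace T T' : (forall a b, T a b = T' a b) -> atrace T = atrace T'.
Proof. by move=> e; apply: eq_bigr => a _; apply: eq_bigr => b _; rewrite e. Qed.

Lemma atraceD T T' : atrace (fun a b => T a b + T' a b) = atrace T + atrace T'.
Proof.
rewrite -big_split; apply: eq_bigr => a _; rewrite -big_split.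
by apply: eq_bigr => b _; rewrite mulrDr.
Qed.

Lemma atraceZ c T : atrace (fun a b => c * T a b) = c * atrace T.
Proof.
rewrite mulr_sumr; apply: eq_bigr => a _; rewrite mulr_sumr.
by apply: eq_bigr => b _; rewrite mulrCA.
Qed.

Lemma atraceN T : atrace (fun a b => - T a b) = - atrace T.
Proof. by rewrite -mulN1r -atraceZ; apply: eq_atrace => a b; rewrite mulN1r. Qed.

Lemma atrace_sum (I : finType) (T : I -> 'I_n -> 'I_n -> A) :
  atrace (fun a b => \sum_i T i a b) = \sum_i atrace (T i).
Proof.
rewrite exchange_big; apply: eq_bigr => a _; rewrite exchange_big.
by apply: eq_bigr => b _; rewrite mulr_sumr.
Qed.

Lemma atraceC T : atrace T = atrace (fun a b => T b a).
Proof.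
by rewrite /atrace exchange_big; apply: eq_bigr => a _; apply: eq_bigr => b _;
   rewrite gi_trans.
Qed.

Lemma aricci_sym b e : aricci b e = aricci e b.
Proof.
by rewrite !aricci_trace [RHS]atraceC; apply: eq_atrace => a c; rewrite riem_pair.
Qed.

Lemma anab2_ricci k b e :
  anab2 aricci k b e = atrace (fun c a => anab4 ariem k c b a e).
Proof.
rewrite /anab2 aricci_trace d_trace.
under [X in _ - X - _ = _]eq_bigr do rewrite aricci_trace -atraceZ.
under [X in _ - _ - X = _]eq_bigr do rewrite aricci_trace -atraceZ.
rewrite -!atrace_sum -!atraceN -!atraceD; apply: eq_atrace => c a.
by rewrite /anab2 /anab4; ring.
Qed.

Lemma contracted_bianchi a b e :
  atrace (fun c k => anab4 ariem k c e a b) = anab2 aricci a e b - anab2 aricci b e a.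
Proof.
rewrite !anab2_ricci -atraceN -atraceD; apply: eq_atrace => c k.
have := riem_bianchi2 k c e a b; rewrite (anab4_skew34 a c e b k) => H.
by apply: (eq_of_sub H); ring.
Qed.

Lemma exchange_sum4 (F : 'I_n -> 'I_n -> 'I_n -> 'I_n -> A) :
  \sum_i \sum_j \sum_k \sum_l F i j k l = \sum_k \sum_l \sum_i \sum_j F i j k l.
Proof.
under eq_bigr do rewrite exchange_big /=.
rewrite exchange_big; apply: eq_bigr => k _ /=.
under eq_bigr do rewrite exchange_big /=.
by rewrite exchange_big.
Qed.

Definition sharp (T : 'I_n -> A) : 'rV[A]_n := \row_k \sum_p gi k p * T p.

Lemma ip_sharp T v : ip (sharp T) v = lin T v.
Proof.
have -> : sharp T = \sum_p T p *: dual p.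
  apply/rowP => k; rewrite !mxE summxE; apply: eq_bigr => p _.
  by rewrite !mxE mulrC gi_trans.
by rewrite ip_suml; apply: eq_bigr => p _; rewrite ipZ1 ip_dualE.
Qed.

Lemma ip_cov_sharp k T v : ip (cov k (sharp T)) v = lin (anab1 T k) v.
Proof.
have := d_lin k T v; rewrite -[lin T v]ip_sharp d_ip -[lin T _]ip_sharp.
by move/addIr.
Qed.

Lemma bil_trace k (F : 'I_k -> 'I_k -> 'I_n -> 'I_n -> A) u v :
  bil (fun b e => atrace (F b e)) u v = atrace (fun c a => bil (fun b e => F b e c a) u v).
Proof.
rewrite bil_suml; apply: eq_bigr => c _; rewrite bil_suml; apply: eq_bigr => a _.
by rewrite bilZl.
Qed.

Lemma lin_trace k (F : 'I_k -> 'I_n -> 'I_n -> A) u :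
  lin (fun b => atrace (F b)) u = atrace (fun c a => lin (fun b => F b c a) u).
Proof.
rewrite lin_suml; apply: eq_bigr => c _; rewrite lin_suml; apply: eq_bigr => a _.
by rewrite linZl.
Qed.

Lemma anab2_sym T k a b : (forall a b, T a b = T b a) -> anab2 T k a b = anab2 T k b a.
Proof.
move=> sT; rewrite /anab2 sT addrAC; congr (_ - _ - _);
  by apply: eq_bigr => l _; rewrite sT.
Qed.

Lemma anab3_sym23 T k a b c : (forall a b c, T a b c = T a c b) ->
  anab3 T k a b c = anab3 T k a c b.
Proof.
move=> sT; rewrite /anab3 sT.
under eq_bigr do rewrite sT.
under [X in _ - _ - X - _ = _]eq_bigr do rewrite sT.
under [X in _ - _ - _ - X = _]eq_bigr do rewrite sT.
ring.
Qed.

Lemma anab3_swap12 T k a b c : anab3 T k a b c = anab3 (fun x y z => T y x z) k b a c.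
Proof. rewrite /anab3; ring. Qed.

Lemma anab3D T T' C k a b c : (forall a b c, T a b c = T' a b c + C a b c) ->
  anab3 T k a b c = anab3 T' k a b c + anab3 C k a b c.
Proof.
move=> sT; rewrite /anab3 sT dD.
under eq_bigr do rewrite sT mulrDr.
under [X in _ - _ - X - _ = _]eq_bigr do rewrite sT mulrDr.
under [X in _ - _ - _ - X = _]eq_bigr do rewrite sT mulrDr.
rewrite !big_split /=; ring.
Qed.

Lemma anab2_m2D T T1 T2 k a b : (forall a b, T a b = - 2 * (T1 a b + T2 a b)) ->
  anab2 T k a b = - 2 * (anab2 T1 k a b + anab2 T2 k a b).
Proof.
move=> TE; rewrite /anab2 TE dM dN !dD d1.
under eq_bigr do rewrite TE mulrCA mulrDr.
under [X in _ - _ - X = _]eq_bigr do rewrite TE mulrCA mulrDr.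
rewrite -!mulr_sumr !big_split /=; ring.
Qed.

Lemma ahessD x y i j : ahess (x + y) i j = ahess x i j + ahess y i j.
Proof.
rewrite /ahess /anab1 /apart !dD; under eq_bigr do rewrite dD mulrDr.
rewrite big_split /=; ring.
Qed.

Lemma ahess_sym f a b : ahess f a b = ahess f b a.
Proof.
rewrite /ahess /anab1 /apart dC; congr (_ - _).
by apply: eq_bigr => l _; rewrite chr_sym.
Qed.

Lemma hess_trace T i j :
  atrace (fun k l => anab3 (anab2 T) i j k l) = ahess (atrace T) i j.
Proof.
rewrite /ahess /anab1 /apart d_trace d_trace.
under [X in _ = _ - X]eq_bigr do rewrite d_trace -atraceZ.
rewrite -atrace_sum -atraceN -atraceD; apply: eq_atrace => k l.
by rewrite /anab2 /anab3; ring.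
Qed.

Lemma alie2E (X : 'I_n -> A) T i j : (forall a b, T a b = T b a) ->
  alie2 X T i j = lin (fun k => anab2 T k i j) (\row_k X k)
    + lin (T j) (cov i (\row_k X k)) + lin (T i) (cov j (\row_k X k)).
Proof.
move=> sT; set x := \row_k X k; have xE k : x 0 k = X k by rewrite mxE.
have E a b : lin (T b) (cov a x) = \sum_k T k b * d a (X k)
   + lin (fun c => \sum_l achr l c a * T l b) x.
  rewrite /lin; under eq_bigr do rewrite mxE xE mulrDr mulr_sumr.
  rewrite big_split /=; congr (_ + _).
    by apply: eq_bigr => k _; rewrite sT.
  rewrite exchange_big; apply: eq_bigr => c _; rewrite mulr_suml.
  by apply: eq_bigr => l _; rewrite (sT b) (chr_sym l a); ring.
have F : lin (fun k => anab2 T k i j) x = \sum_k X k * d k (T i j)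
   - lin (fun c => \sum_l achr l c i * T l j) x
   - lin (fun c => \sum_l achr l c j * T l i) x.
  have -> : \sum_k X k * d k (T i j) = lin (fun k => d k (T i j)) x.
    by apply: eq_bigr => k _; rewrite xE mulrC.
  rewrite -!linNl -!linDl; apply: eq_lin => k; rewrite /anab2.
  by under [X in _ - _ - X = _]eq_bigr do rewrite sT.
rewrite F !E /alie2 !big_split /=.
have -> : \sum_k T i k * d j (X k) = \sum_k T k i * d j (X k).
  by apply: eq_bigr => k _; rewrite sT.
ring.
Qed.

Section Skew.
Variable T : 'I_n -> 'I_n -> 'I_n -> 'I_n -> A.
Hypotheses (skT : forall a b c e, T a b c e = - T a b e c)
  (pairT : forall a b c e, T a b c e = T c e a b).

Lemma quad_pairC u v w z : quad T u v w z = quad T w z u v.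
Proof. by rewrite quad_pair; apply: eq_quad. Qed.

Lemma quad_skew34 u v w z : quad T u v w z = - quad T u v z w.
Proof. by rewrite quad_swap34 -quadNl; apply: eq_quad. Qed.

Lemma quad_skew12 u v w z : quad T u v w z = - quad T v u w z.
Proof. by rewrite quad_pairC quad_skew34 quad_pairC. Qed.

Lemma quad_skew34_0 u v w : quad T u v w w = 0.
Proof.
apply: half_cancel; rewrite mul0r mulr_natr mulr2n {1}quad_skew34.
by rewrite addNr.
Qed.

Lemma quad_skew12_0 u w z : quad T u u w z = 0.
Proof. by rewrite quad_pairC quad_skew34_0. Qed.

End Skew.

Lemma alie2_g f i j : alie2 (agrad f) g i j = 2 * ahess f i j.
Proof.
rewrite alie2E // -[\row__ _]/(sharp (apart f)).
have E a b : lin (g b) (cov a (sharp (apart f))) = ahess f a b.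
  by rewrite -bil_bvec1 -/(ip _ _) ipC ip_cov_sharp lin_bvec.
rewrite !E (ahess_sym f j) /lin big1 ?add0r => [|a _]; last by rewrite anab2_g mul0r.
by rewrite mulrDl mul1r.
Qed.

Lemma ip_grad f h : \sum_i \sum_j g i j * agrad f i * agrad h j =
  lin (apart h) (sharp (apart f)).
Proof.
rewrite -ip_sharp ipC; apply: eq_bigr => i _; rewrite mulr_suml.
by apply: eq_bigr => j _; rewrite !mxE mulrAC.
Qed.

Section Variation.
Variables (D : A -> A) (derD : derivation D) (DC : forall a x, D (d a x) = d a (D x)).

Let h a b := D (g a b).

Lemma D_gi a b : D (gi a b) = - \sum_k \sum_l gi a k * h k l * gi l b.
Proof.
have E c : \sum_l D (gi a l) * g l c = - \sum_l gi a l * h l c.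
  have := der_bool derD (a == c); rewrite -gi_g (der_sum derD).
  under eq_bigr do rewrite (derM derD).
  by rewrite big_split /= => /eqP; rewrite addr_eq0 => /eqP.
rewrite -[LHS](sum_delta (fun l => D (gi a l))).
under eq_bigr => l _ do rewrite -g_gi mulr_sumr.
rewrite exchange_big /=.
under eq_bigr => c _ do under eq_bigr => l _ do rewrite mulrA.
under eq_bigr => c _ do rewrite -mulr_suml E mulNr mulr_suml.
by rewrite sumrN exchange_big.
Qed.

Lemma D_trace T : D (atrace T) =
  atrace (fun a b => D (T a b)) - \sum_k \sum_l h k l * araise2 T k l.
Proof.
transitivity (\sum_i \sum_j (gi i j * D (T i j) + D (gi i j) * T i j)).
  rewrite /atrace (der_sum derD); apply: eq_bigr => i _.
  by rewrite (der_sum derD); apply: eq_bigr => j _; rewrite (derM derD) addrC.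
under eq_bigr do rewrite big_split /=.
rewrite big_split /= -[LHS]/(atrace _ + _); congr (_ + _); rewrite -sumrN.
under eq_bigr => i _ do under eq_bigr => j _ do rewrite D_gi mulNr mulr_suml.
under eq_bigr => i _ do under eq_bigr => j _ do under eq_bigr => k _ do
  rewrite mulr_suml.
under eq_bigr => i _ do rewrite sumrN.
rewrite !sumrN; congr (- _).
transitivity (\sum_i \sum_j \sum_k \sum_l gi i k * h k l * gi l j * T i j).
  by [].
rewrite exchange_sum4; apply: eq_bigr => k _.
apply: eq_bigr => l _; rewrite mulr_sumr; apply: eq_bigr => i _.
rewrite mulr_sumr; apply: eq_bigr => j _.
rewrite (gi_trans i k); ring.
Qed.

Definition D_chr (a b : 'I_n) : 'rV[A]_n := \row_c D (achr c a b).

Lemma ip_D_chr a b c : 2 * ip (D_chr a b) (e_ c) =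
  anab2 h a b c + anab2 h b a c - anab2 h c a b.
Proof.
have h_sym x y : h x y = h y x by rewrite /h g_sym.
have E : ip (D_chr a b) (e_ c) =
   half * (d a (h b c) + d b (h a c) - d c (h a b)) - \sum_l achr l a b * h l c.
  have := congr1 D (chr_low a b c).
  rewrite (derM derD) (der_half derD half2) mul0r add0r (derB derD) (derD_ derD) !DC.
  rewrite ![ip _ (e_ c)]ipC /ip !bil_bvec1 lin_cov_bvec (der_sum derD).
  under eq_bigr do rewrite (derM derD).
  rewrite big_split /= => H; apply: (eq_of_sub H); rewrite /lin.
  under [X in X - _ = _]eq_bigr do rewrite mxE mulrC g_sym.
  under [X in _ = _ + X - _]eq_bigr do rewrite -/(h _ _) h_sym.
  by rewrite /h; under [X in _ = X + _ - _]eq_bigr do rewrite g_sym; ring.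
rewrite E mulrBr mulrA [2 * half]mulrC half2 mul1r /anab2.
rewrite (eq_bigr _ (fun l _ => congr1 (fun x => x * h l c) (chr_sym l b a))).
have -> : \sum_l achr l c a * h l b = \sum_l achr l a c * h b l.
  by apply: eq_bigr => l _; rewrite chr_sym h_sym.
have -> : \sum_l achr l c b * h a l = \sum_l achr l b c * h a l.
  by apply: eq_bigr => l _; rewrite chr_sym.
ring.
Qed.

End Variation.
End AlgebraicGeometry.

(** * Hypersurfaces *)

Section Hypersurface.
Context {A : comPzRingType} {m : nat}.
Variables (G : ageom A m.+1) (ghi : 'I_m -> 'I_m -> A) (N : A).
Local Notation tg := (lift ord0).
Hypothesis ghi_g : forall i j, \sum_l ghi i l * ag_g G (tg l) (tg j) = (i == j)%:R.
Hypothesis NN : N * N * ag_gi G ord0 ord0 = 1.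

(* The induced geometry on the level sets of x^0, with the same ring of functions. *)
Definition leaf : ageom A m :=
  @AGeom A m (ag_half G) (fun i => ag_d G (tg i))
    (fun i j => ag_g G (tg i) (tg j)) ghi (ag_half2 G) (fun i => ag_der G (tg i))
    (fun i j => @ag_dC _ _ G (tg i) (tg j)) (fun i j => @ag_gC _ _ G (tg i) (tg j))
    ghi_g.

Local Notation L := leaf.
Local Notation d := (ag_d G).
Local Notation et i := (@bvec A m.+1 (tg i)).
Local Notation eh := (@bvec A m).

(* [nu] is a variable rather than a definition so that rewriting with the linearity
   lemmas does not unfold it. *)
Variable nu : 'rV[A]_m.+1.
Hypothesis nu_def : nu = N *: dual G ord0.
Definition incl (x : 'rV[A]_m) : 'rV[A]_m.+1 := \sum_i x 0 i *: et i.
Definition asff (i j : 'I_m) : A := ip G nu (cov G (tg i) (et j)).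
Definition amean : A := atrace L asff.
Definition shape (i : 'I_m) : 'rV[A]_m := sharp L (asff i).

Lemma ip_nu v : ip G nu v = N * v 0 ord0.
Proof. by rewrite nu_def ipZ1 ip_dualE. Qed.

Lemma nu_nu : ip G nu nu = 1.
Proof. by rewrite ip_nu nu_def !mxE mulrA NN. Qed.

Lemma nu_et i : ip G nu (et i) = 0.
Proof. by rewrite ip_nu mxE mulr0. Qed.

Lemma inclD x y : incl (x + y) = incl x + incl y.
Proof.
by rewrite -big_split; apply: eq_bigr => i _; rewrite mxE scalerDl.
Qed.

Lemma inclZ a x : incl (a *: x) = a *: incl x.
Proof.
by rewrite scaler_sumr; apply: eq_bigr => i _; rewrite mxE scalerA.
Qed.

Lemma inclN x : incl (- x) = - incl x.
Proof. by rewrite -scaleN1r inclZ scaleN1r. Qed.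

Lemma incl_bvec i : incl (eh i) = et i.
Proof.
rewrite /incl (bigD1 i) //= mxE !eqxx scale1r big1 ?addr0 // => j /negbTE ij.
by rewrite mxE ij andbF scale0r.
Qed.

Lemma lin_incl T x : lin T (incl x) = lin (fun i => T (tg i)) x.
Proof. by rewrite lin_sum; apply: eq_bigr => i _; rewrite linZ lin_bvec mulrC. Qed.

Lemma bil_incl T x y : bil T (incl x) (incl y) = bil (fun i j => T (tg i) (tg j)) x y.
Proof. by rewrite /bil lin_incl; apply: eq_lin => i; rewrite lin_incl. Qed.

Lemma bil_incl1 T x v : bil T (incl x) v = lin (fun i => bil T (et i) v) x.
Proof. by rewrite /bil lin_incl; apply: eq_lin => i; rewrite lin_bvec. Qed.

Lemma bil_incl2 T v x : bil T v (incl x) = lin (fun i => bil T v (et i)) x.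
Proof. by rewrite bilC bil_incl1; apply: eq_lin => i; rewrite bilC. Qed.

Lemma ip_incl x y : ip G (incl x) (incl y) = ip L x y.
Proof. exact: bil_incl. Qed.

Lemma nu_incl x : ip G nu (incl x) = 0.
Proof. by rewrite /ip bil_incl2 /lin big1 // => i _; rewrite [bil _ _ _]nu_et mul0r. Qed.

(* g^{0b} d_b is a multiple of nu, so nu and the d_i determine the pairing with d_0. *)
Lemma tang_eq u v : (forall i, ip G u (et i) = ip G v (et i)) ->
  ip G u nu = ip G v nu -> u = v.
Proof.
move=> tgE nuE; apply: (@ip_inj _ _ G) => b; case: (unliftP ord0 b) => [i|] -> //.
have NE w : \sum_c ag_gi G ord0 c * ip G w (bvec c) = ag_gi G ord0 ord0 * ip G w (bvec ord0)
   + \sum_i ag_gi G ord0 (tg i) * ip G w (et i) by rewrite big_ord_recl.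
have E w : ip G w nu = N * \sum_c ag_gi G ord0 c * ip G w (bvec c).
  rewrite nu_def ipZ2; congr (_ * _); rewrite {1}[dual _ _]bvec_sum ip_sumr.
  by apply: eq_bigr => c _; rewrite ipZ2 mxE.
have F w : ip G w (bvec ord0) = N * (ip G w nu
   - N * \sum_i ag_gi G ord0 (tg i) * ip G w (et i)).
  rewrite E NE -[LHS]mul1r -NN; ring.
by rewrite !F nuE; under eq_bigr do rewrite tgE.
Qed.

Lemma asff_sym i j : asff i j = asff j i.
Proof. by rewrite /asff torsion_free. Qed.

Lemma gauss_formula i x :
  cov G (tg i) (incl x) = incl (cov L i x) + lin (asff i) x *: nu.
Proof.
apply: tang_eq => [k|]; last first.
  rewrite ipC [RHS]ipC ipD2 nu_incl add0r ipZ2 nu_nu mulr1.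
  have := d_ip G (tg i) nu (incl x); rewrite nu_incl der0; last exact: ag_der.
  move/eqP; rewrite eq_sym addrC addr_eq0 => /eqP ->.
  rewrite /ip bil_incl2 -linNl; apply: eq_lin => j.
  have := d_ip G (tg i) nu (et j); rewrite nu_et der0; last exact: ag_der.
  move/eqP; rewrite eq_sym addr_eq0 -[bil _ _ _]/(ip G _ _) => /eqP ->.
  by rewrite opprK.
rewrite ipD1 ipZ1 nu_et mulr0 addr0 -[in RHS]incl_bvec ip_incl.
have H := d_ip G (tg i) (incl x) (et k).
have := d_ip L i x (eh k); rewrite -ip_incl incl_bvec [ag_d _ _ _]H => /esym.
rewrite -incl_bvec; have -> : ip G (incl x) (cov G (tg i) (incl (eh k))) =
    ip L x (cov L i (eh k)); last by move/addIr.
rewrite ipC [RHS]ipC /ip bil_incl2 [bil (ag_g L) _ _]bilC.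
rewrite -[RHS]/(lin _ _); apply: eq_lin => j.
transitivity (ip L (cov L i (eh k)) (eh j)); last by rewrite /ip bilC bil_bvec1.
by rewrite chr_low -[LHS]/(ip G _ _) incl_bvec chr_low.
Qed.

Lemma ip_nu_cov_nu i : ip G (cov G i nu) nu = 0.
Proof.
apply: (@half_cancel _ _ G); rewrite mul0r.
have := d_ip G i nu nu; rewrite nu_nu der1; last exact: ag_der.
by rewrite [ip G nu _]ipC => ->; rewrite mulr_natr mulr2n.
Qed.

Lemma weingarten i : cov G (tg i) nu = - incl (shape i).
Proof.
apply: tang_eq => [j|]; last by rewrite ip_nu_cov_nu ipN1 ipC nu_incl oppr0.
have := d_ip G (tg i) nu (et j); rewrite nu_et der0; last exact: ag_der.
move/eqP; rewrite eq_sym addr_eq0 => /eqP ->; rewrite ipN1; congr (- _).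
by rewrite -(incl_bvec j) ip_incl ip_sharp lin_bvec incl_bvec.
Qed.

Lemma curv_leaf i j k : curv G (tg i) (tg j) (et k) =
  incl (curv L i j (eh k)) + (anab2 L asff i j k - anab2 L asff j i k) *: nu
  - asff j k *: incl (shape i) + asff i k *: incl (shape j).
Proof.
have E a b : cov G (tg a) (cov G (tg b) (et k)) =
    incl (cov L a (cov L b (eh k)))
    + (lin (asff a) (cov L b (eh k)) + d (tg a) (asff b k)) *: nu
    - asff b k *: incl (shape a).
  rewrite -incl_bvec gauss_formula lin_bvec covD covZ gauss_formula weingarten.
  by rewrite scalerN scalerDl !addrA.
have F a b : d (tg a) (asff b k) = anab2 L asff a b k
    + lin (asff^~ k) (cov L a (eh b)) + lin (asff b) (cov L a (eh k)).
  have := d_bil L a asff (eh b) (eh k); rewrite bil_bvec -[ag_d L a _]/(d (tg a) _) => ->.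
  by rewrite bil_bvec bil_bvec1 bilC bil_bvec1.
rewrite /curv !E !F (torsion_free L j i) inclD inclN.
move: (incl _) (incl (cov L j _)) (incl (shape i)) (incl (shape j)) => a b c e.
by apply/rowP => z; rewrite !mxE; ring.
Qed.

Lemma codazzi l i j : anab2 L asff l i j = anab2 L asff i l j
  + quad (ariem G) nu (et j) (et l) (et i).
Proof.
rewrite -ip_curv curv_leaf !(nu_nu, nu_incl, ipD2, ipN2, ipZ2); ring.
Qed.

Lemma gauss_equation i j k y : ip L (curv L i j (eh k)) y =
  ip G (curv G (tg i) (tg j) (et k)) (incl y)
  + asff j k * lin (asff i) y - asff i k * lin (asff j) y.
Proof.
by rewrite curv_leaf !(ip_incl, nu_incl, ip_sharp, ipD1, ipN1, ipZ1); ring.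
Qed.

Lemma frame_trace T :
  atrace G T = bil T nu nu + atrace L (fun k l => T (tg k) (tg l)).
Proof.
pose ee (a : 'I_m.+1) (l : 'I_m) : A := (a == tg l)%:R.
have E a : dual G a = nu 0 a *: nu + incl (sharp L (ee a)).
  apply: tang_eq => [i|].
    rewrite ip_dual ipD1 ipZ1 nu_et mulr0 add0r -(incl_bvec i) ip_incl ip_sharp.
    by rewrite lin_bvec.
  by rewrite ip_dualE ipD1 ipZ1 nu_nu mulr1 [ip G (incl _) _]ipC nu_incl addr0.
rewrite atrace_bil; under eq_bigr do rewrite E bilD2 bilZ2.
rewrite big_split /=; congr (_ + _).
  by under eq_bigr do rewrite bil_bvec1 mulrC.
under eq_bigr do rewrite bil_incl2.
rewrite big_ord_recl /lin big1 ?add0r => [|l _]; last first.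
  by rewrite mxE big1 ?mulr0 // => p _; rewrite /ee /= mulr0.
apply: eq_bigr => k _; apply: eq_bigr => l _.
rewrite bil_bvec mxE mulrC (gi_trans L l k); congr (_ * _).
rewrite -[RHS](sum_delta (ag_gi L l)); apply: eq_bigr => p _.
by rewrite /ee (inj_eq lift_inj) eq_sym.
Qed.


Lemma frame_trace4 T Ric u v : (forall b e, Ric b e = atrace G (fun c a => T c b a e)) ->
  bil Ric u v = quad T nu u nu v + atrace L (fun k l => quad T (et k) u (et l) v).
Proof.
move=> RicE; rewrite -bil_quad.
under [X in _ + X]eq_atrace => k l do rewrite -bil_quad.
rewrite -bil_trace -bilDl; apply: eq_bil => b e; rewrite RicE frame_trace.
by congr (_ + _); apply: eq_atrace => k l; rewrite bil_bvec.
Qed.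

Local Notation R := (quad (ariem G)).
Local Notation DR k := (quad (anab4 G (ariem G) k)).
Local Notation Ric := (bil (aricci G)).
Local Notation DRic k := (bil (anab2 G (aricci G) k)).
Let R_skew34 := quad_skew34 (@riem_skew34 A m.+1 G).
Let R_pair := quad_pairC (@riem_pair A m.+1 G).
Let R_skew12 := quad_skew12 (@riem_skew34 A m.+1 G) (@riem_pair A m.+1 G).
Let R_00 u w z : R u u w z = 0 :=
  quad_skew12_0 G (@riem_skew34 A m.+1 G) (@riem_pair A m.+1 G) u w z.
Let DR_skew34 k := quad_skew34 (@anab4_skew34 A m.+1 G k).
Let DR_pair k := quad_pairC (@anab4_pair A m.+1 G k).
Let DR_skew12 k := quad_skew12 (@anab4_skew34 A m.+1 G k) (@anab4_pair A m.+1 G k).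
Let DR_00 k u w z : DR k u u w z = 0 :=
  quad_skew12_0 G (@anab4_skew34 A m.+1 G k) (@anab4_pair A m.+1 G k) u w z.

Lemma quad_incl2 T u x w z :
  quad T u (incl x) w z = lin (fun i => quad T u (et i) w z) x.
Proof. by rewrite quad_lin2 lin_incl. Qed.

Lemma quad_incl3 T u v x z :
  quad T u v (incl x) z = lin (fun i => quad T u v (et i) z) x.
Proof. by rewrite quad_lin3 lin_incl. Qed.

Lemma quad_incl4 T u v w x :
  quad T u v w (incl x) = lin (fun i => quad T u v w (et i)) x.
Proof. by rewrite quad_lin4 lin_incl. Qed.

(* The right-hand side R_{nu j l i} of the Codazzi equation. *)
Definition cod (l i j : 'I_m) : A := R nu (et j) (et l) (et i).

Lemma anab3_cod k l i j : anab3 L cod k l i j =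
  DR (tg k) nu (et j) (et l) (et i) - R (incl (shape k)) (et j) (et l) (et i)
  + asff k l * R nu (et j) nu (et i) + asff k i * R nu (et j) (et l) nu.
Proof.
have triE x y z : tri cod x y z = R nu (incl z) (incl x) (incl y).
  rewrite quad_incl3; apply: eq_lin => a; rewrite quad_incl4; apply: eq_lin => b.
  by rewrite quad_incl2.
have := d_tri L k cod (eh l) (eh i) (eh j).
rewrite (tri_bvec1 (anab3 L cod k)) bil_bvec !triE [ag_d L k _]d_quad !incl_bvec weingarten.
rewrite -[in et l](incl_bvec l) -[in et i](incl_bvec i) -[in et j](incl_bvec j).
rewrite !gauss_formula !incl_bvec !lin_bvec.
rewrite !(quadD2, quadD3, quadD4, quadZ2, quadZ3, quadZ4, quadN1) R_00 => H.
by apply: (eq_of_sub (esym H)); ring.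
Qed.

Definition Asq (i j : 'I_m) : A := lin (asff i) (shape j).
Definition RmTr (k j : 'I_m) : A :=
  \sum_l \sum_p ghi l p * ariem G (tg p) (tg k) (tg l) (tg j).
Definition ARmTr (i j : 'I_m) : A := \sum_k araise1 L asff k i * RmTr k j.
Definition ARm (i j : 'I_m) : A :=
  \sum_k \sum_l araise2 L asff k l * ariem G (tg k) (tg i) (tg l) (tg j).
Definition normA2 : A := \sum_k \sum_l araise2 L asff k l * asff k l.
Definition nab0_riem (i j : 'I_m) : A := \sum_a \sum_b \sum_c
  nu 0 a * nu 0 b * nu 0 c * anab4 G (ariem G) a b (tg i) c (tg j).
Definition nab0_ric : A := \sum_a \sum_b \sum_c
  nu 0 a * nu 0 b * nu 0 c * anab2 G (aricci G) a b c.

Lemma trace_asff i T : atrace L (fun k l => asff i k * T l) = lin T (shape i).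
Proof.
rewrite atraceC; apply: eq_bigr => l _; rewrite mxE mulr_sumr.
by apply: eq_bigr => p _; rewrite mulrA mulrC.
Qed.

Lemma araise2_trace T : \sum_k \sum_l araise2 L asff k l * T k l =
  atrace L (fun k l => lin (T k) (shape l)).
Proof.
apply: eq_bigr => k _; rewrite /lin.
under [RHS]eq_bigr do rewrite mulr_sumr.
rewrite [RHS]exchange_big; apply: eq_bigr => l _; rewrite mulr_suml.
apply: eq_bigr => p _; rewrite mxE [T k l * _]mulrC mulrA mulr_sumr.
by congr (_ * _); apply: eq_bigr => q _; rewrite mulrA.
Qed.

Lemma AsqC i j : Asq i j = Asq j i.
Proof. by rewrite /Asq -!(ip_sharp L) -/(shape _) -/(shape _) ipC. Qed.

Lemma bil_asffC x y : bil asff x y = bil asff y x.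
Proof. by rewrite bilC; apply: eq_bil => a b; rewrite asff_sym. Qed.

Lemma AsqE i j : Asq i j = \sum_k asff i k * araise1 L asff k j.
Proof.
apply: eq_bigr => k _; rewrite mxE; congr (_ * _).
by apply: eq_bigr => p _; rewrite asff_sym.
Qed.

Lemma ARmTrE i j :
  ARmTr i j = atrace L (fun l p => R (et p) (incl (shape i)) (et l) (et j)).
Proof.
transitivity (lin (fun k => atrace L
    (fun l p => ariem G (tg p) (tg k) (tg l) (tg j))) (shape i)).
  apply: eq_bigr => k _; rewrite mxE mulrC; congr (_ * _).
  by apply: eq_bigr => p _; rewrite asff_sym.
rewrite lin_trace; apply: eq_atrace => l p; rewrite quad_incl2.
by apply: eq_lin => k; rewrite quad_bvec.
Qed.

Lemma ARmE i j :
  ARm i j = atrace L (fun k l => R (et k) (et i) (incl (shape l)) (et j)).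
Proof.
rewrite /ARm araise2_trace; apply: eq_atrace => k l; rewrite quad_incl3.
by apply: eq_lin => p; rewrite quad_bvec.
Qed.

Lemma trace_div_riem i j :
  atrace L (fun k l => DR (tg k) nu (et j) (et l) (et i)) =
  lin (fun a => anab2 G (aricci G) a (tg i) (tg j)) nu
  - DRic (tg j) (et i) nu - nab0_riem i j.
Proof.
have E a := contracted_bianchi G a (tg j) (tg i).
have F : lin (fun a => atrace G (fun c k => anab4 G (ariem G) k c (tg i) a (tg j))) nu
  = nab0_riem i j + atrace L (fun l k => DR (tg k) (et l) (et i) nu (et j)).
  under eq_lin do rewrite frame_trace.
  rewrite linDl lin_trace; congr (_ + _).
    rewrite /nab0_riem -(triE (fun a b c => anab4 G _ a b _ c _)).
    by rewrite tri_swap12 tri_swap23 tri_swap12.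
  apply: eq_atrace => l k; rewrite quad_bvec1 tri_bvec1.
  by apply: eq_lin => a; rewrite lin_bvec.
rewrite atraceC.
under eq_atrace => k l do rewrite DR_pair.
apply: (eq_of_sub (esym F)); under [X in _ = _ - X]eq_lin => a do rewrite E.
by rewrite linDl linNl bil_bvec1; ring.
Qed.

(* Simons' identity: exchange the derivatives of nabla_k nabla_l A_ij by Codazzi, then
   Ricci, then Codazzi, and trace over (k, l). *)
Lemma simons i j : alapl2 L asff i j =
  ahess L amean i j - DRic (tg i) nu (et j) - asff i j * Ric nu nu
  + lin (fun a => anab2 G (aricci G) a (tg i) (tg j)) nu - DRic (tg j) (et i) nu
  - nab0_riem i j - 2 * ARm i j + amean * R nu (et j) nu (et i)
  + ARmTr i j + ARmTr j i - normA2 * asff i j + amean * Asq i j.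
Proof.
have step k l : anab3 L (anab2 L asff) k l i j =
    anab3 L (anab2 L asff) i j k l + anab3 L cod k l i j + anab3 L cod i k j l
    - bil asff (curv L k i (eh l)) (eh j) - bil asff (eh l) (curv L k i (eh j)).
  have codA a b c e : anab3 L (anab2 L asff) a b c e =
      anab3 L (anab2 L asff) a c b e + anab3 L cod a b c e.
    rewrite [X in _ = X + _]anab3_swap12; apply: anab3D => x y z.
    exact: codazzi.
  have sym23 a b c e : anab3 L (anab2 L asff) a b c e = anab3 L (anab2 L asff) a b e c.
    by apply: anab3_sym23 => x y z; apply: anab2_sym; exact: asff_sym.
  have := ricci_id2 L asff k i l j => /eqP; rewrite subr_eq => /eqP H.
  by rewrite codA H sym23 codA; ring.
have bilS x b : bil asff x (eh b) = ip L x (shape b).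
  by rewrite ipC ip_sharp bil_asffC bil_bvec1.
have bilS' x b : bil asff (eh b) x = ip L x (shape b) by rewrite bil_asffC.
rewrite -[LHS]/(atrace L (fun k l => anab3 L (anab2 L asff) k l i j)).
under eq_atrace => k l.
  rewrite step bilS bilS' !gauss_equation ![ip G (curv _ _ _ _) _]ipC !ip_curv.
  rewrite !anab3_cod [asff k i]asff_sym [DR (tg i) nu _ _ _]DR_skew12.
  rewrite [R nu (et l) (et k) nu]R_skew34 [R nu (et l) nu (et k)]R_skew12.
  over.
have := hess_trace L asff i j.
move: (anab3 L (anab2 L asff) i j) => D3 H3.
rewrite !(atraceD, atraceN) H3 trace_div_riem !trace_asff.
have t1 : atrace L (fun k l => R (incl (shape k)) (et j) (et l) (et i)) = ARm i j.
  by rewrite ARmE atraceC; apply: eq_atrace => k l; rewrite R_pair.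
have t2 : atrace L (fun k l => R (incl (shape l)) (et j) (et k) (et i)) = ARm i j.
  by rewrite ARmE; apply: eq_atrace => k l; rewrite R_pair.
have t3 x : atrace L (fun k l => asff k l * x) = amean * x.
  by rewrite mulrC -atraceZ; apply: eq_atrace => k l; rewrite mulrC.
have t4 : atrace L (fun k l => DR (tg i) (et l) nu (et k) (et j)) = DRic (tg i) nu (et j).
  rewrite atraceC (@frame_trace4 (anab4 G (ariem G) (tg i))) ?DR_00 ?add0r //.
  exact: anab2_ricci.
have t5 x y : atrace L (fun k l => R (incl (shape x)) (et l) (et k) (et y)) = - ARmTr x y.
  by rewrite ARmTrE -atraceN; apply: eq_atrace => k l; rewrite R_skew12.
have t6 : atrace L (fun k l => asff i j * - - R (et l) nu nu (et k)) =
    - (asff i j * Ric nu nu).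
  rewrite atraceZ -mulrN; congr (_ * _).
  rewrite (@frame_trace4 (ariem G)) ?R_00 ?add0r; last exact: aricci_trace.
  rewrite atraceC -atraceN; apply: eq_atrace => k l.
  by rewrite R_skew34 opprK.
have t7 : atrace L (fun k l => asff i l * lin (asff k) (shape j)) =
    bil asff (shape i) (shape j).
  by rewrite atraceC trace_asff.
have t8 : atrace L (fun k l => asff k j * lin (asff i) (shape l)) =
    bil asff (shape i) (shape j).
  rewrite bil_asffC -[RHS]trace_asff; apply: eq_atrace => k l.
  by rewrite asff_sym -[lin (asff i) _]AsqC.
have t9 : atrace L (fun k l => asff i j * lin (asff k) (shape l)) = normA2 * asff i j.
  by rewrite atraceZ mulrC /normA2 araise2_trace.
rewrite t1 t2 !t3 t4 !t5 t6 t7 t8 t9 -quad_incl2 -quad_incl3.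
rewrite [R nu (et j) _ nu]R_skew34 [R nu (et j) nu (incl _)]R_pair /Asq.
by ring.
Qed.

Section Potential.
Variable f : A.

Definition normal_df : A := lin (apart G f) nu.
Local Notation Hs := (ahess G f).
Local Notation X := (sharp L (apart L f)).
Definition lieX (i j : 'I_m) : A := alie2 L (agrad L f) asff i j.

Lemma lin_df_incl x : lin (apart G f) (incl x) = lin (apart L f) x.
Proof. exact: lin_incl. Qed.

Lemma hess_tt i j : Hs (tg i) (tg j) = ahess L f i j - asff i j * normal_df.
Proof.
have := gauss_formula i (eh j); rewrite incl_bvec lin_bvec => E.
have := congr1 (lin (apart G f)) E; rewrite lin_cov_bvec linD linZ lin_df_incl.
rewrite lin_cov_bvec => {}E.
by rewrite /ahess /anab1 E /normal_df /apart /=; ring.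
Qed.

Lemma hess_nu_t i : bil Hs (et i) nu = ag_d G (tg i) normal_df + lin (asff i) X.
Proof.
have := d_lin G (tg i) (apart G f) nu; rewrite -/normal_df => ->.
rewrite weingarten linN lin_df_incl -(ip_sharp L (apart L f)) ipC ip_sharp.
by rewrite bil_bvec1 subrK.
Qed.

Lemma hess_t_shape i j : bil Hs (et i) (incl (shape j)) =
  lin (asff j) (cov L i X) - normal_df * Asq i j.
Proof.
rewrite bil_incl2; under eq_lin => k do rewrite bil_bvec hess_tt addrC.
rewrite linDl linNl addrC /Asq -linZl; congr (_ - _); last first.
  by apply: eq_lin => k; rewrite mulrC.
by rewrite -[RHS](ip_sharp L) ipC ip_cov_sharp.
Qed.

Lemma lieXE i j : lieX i j = lin (fun k => anab2 L asff k i j) X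
  + lin (asff j) (cov L i X) + lin (asff i) (cov L j X).
Proof.
exact/alie2E/asff_sym.
Qed.

Lemma grad_split : sharp G (apart G f) = incl X + normal_df *: nu.
Proof.
apply: tang_eq => [i|].
  by rewrite ip_sharp lin_bvec ipD1 ipZ1 nu_et mulr0 addr0 -(incl_bvec i) ip_incl
    ip_sharp lin_bvec.
by rewrite ip_sharp ipD1 ipZ1 nu_nu mulr1 [ip G (incl _) _]ipC nu_incl add0r.
Qed.

Local Notation F := (anab2 G Hs).

Lemma nab_hess_nu i j : bil (F (tg j)) (et i) nu = ahess L normal_df j i
  + lin (anab2 L asff j i) X + lin (asff i) (cov L j X) + lin (asff j) (cov L i X)
  - asff i j * bil Hs nu nu - normal_df * Asq i j.
Proof.
have := d_bil G (tg j) Hs (et i) nu.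
rewrite hess_nu_t weingarten bilN2 hess_t_shape derD_; last exact: ag_der.
have -> : ag_d G (tg j) (lin (asff i) X) = lin (anab2 L asff j i) X
    + bil asff (cov L j (eh i)) X + lin (asff i) (cov L j X).
  by have := d_bil L j asff (eh i) X; rewrite !bil_bvec1.
rewrite -[in cov _ _ (et i)]incl_bvec gauss_formula lin_bvec bilD1 bilZ1 bil_incl1.
under [X in _ = _ + (X + _) + _ -> _]eq_lin => k do rewrite hess_nu_t.
rewrite linDl -[lin (fun _ => lin _ X) _]/(bil asff _ _).
have -> : lin (fun k => ag_d G (tg k) normal_df) (cov L j (eh i)) =
    ag_d G (tg j) (ag_d G (tg i) normal_df) - ahess L normal_df j i.
  by rewrite /ahess /anab1 /apart /= lin_cov_bvec; ring.
rewrite (asff_sym j i) AsqC => H; apply: (eq_of_sub (esym H)); ring.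
Qed.

(* The Ricci identity for df; Codazzi turns its curvature term along X into
   derivatives of A. *)
Lemma nab_hess_commute i j : lin (fun a => F a (tg i) (tg j)) nu =
  bil (F (tg i)) (et j) nu - lin (fun p => anab2 L asff p j i - anab2 L asff j p i) X
  - normal_df * R nu (et j) nu (et i).
Proof.
have E a : F a (tg i) (tg j) = F (tg i) (tg j) a
    - quad (ariem G) (sharp G (apart G f)) (et j) (bvec a) (et i).
  have := ricci_id1 G (apart G f) a (tg i) (tg j).
  rewrite -(ip_sharp G) ip_curv (anab2_sym G (tg i) a (tg j) (ahess_sym G f)) => H.
  by apply: (eq_of_sub H); ring.
under eq_lin do rewrite E.
rewrite linDl linNl -quad_lin3 bil_bvec1 grad_split quadD1 quadZ1 R_pair opprD addrA.
congr (_ - _ - _); rewrite quad_incl3; apply: eq_lin => p.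
by rewrite (codazzi p j i) addrAC subrr add0r.
Qed.

Lemma nab_hess_total i j :
  bil (F (tg i)) (et j) nu + bil (F (tg j)) (et i) nu
    - lin (fun a => F a (tg i) (tg j)) nu =
  ahess L normal_df j i + lieX i j - asff i j * bil Hs nu nu
  + normal_df * (R nu (et j) nu (et i) - Asq i j).
Proof.
rewrite nab_hess_commute (nab_hess_nu i j) lieXE linDl linNl.
have symA a b c := anab2_sym L a b c asff_sym.
have -> : lin (fun p => anab2 L asff p j i) X = lin (fun p => anab2 L asff p i j) X.
  exact: eq_lin.
have -> : lin (fun p => anab2 L asff j p i) X = lin (anab2 L asff j i) X.
  exact: eq_lin.
ring.
Qed.
End Potential.

Section Flow.
Variables (D : A -> A) (derD : derivation D)
  (DC : forall a x, D (ag_d G a x) = ag_d G a (D x)).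

Lemma D_asff i j : 2 * D (asff i j) =
  bil (fun a b => D (ag_g G a b)) nu nu * asff i j
  + lin (anab2 G (fun a b => D (ag_g G a b)) (tg i) (tg j)) nu
  + lin (anab2 G (fun a b => D (ag_g G a b)) (tg j) (tg i)) nu
  - lin (fun c => anab2 G (fun a b => D (ag_g G a b)) c (tg i) (tg j)) nu.
Proof.
set h := fun a b => D (ag_g G a b).
have DN : 2 * D N = N * bil h nu nu.
  have := congr1 D NN; rewrite !(derM derD) (der1 derD) => H.
  have E : D (ag_gi G ord0 ord0) * (N * N) = - bil h nu nu.
    rewrite (D_gi G derD) mulNr mulr_suml; congr (- _); apply: eq_bigr => k _.
    rewrite !mulr_suml; apply: eq_bigr => l _.
    rewrite /h nu_def !mxE (gi_trans G ord0 l); ring.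
  transitivity (2 * D N * (N * N * ag_gi G ord0 ord0)); first by rewrite NN mulr1.
  apply: (eq_of_sub (congr1 (fun x => x * N) H)).
  rewrite -[bil _ _ _]opprK -E; ring.
have E : asff i j = N * achr G ord0 (tg i) (tg j) by rewrite /asff ip_nu cov_bvec mxE.
rewrite E (derM derD).
have -> : N * D (achr G ord0 (tg i) (tg j)) = ip G nu (D_chr G D (tg i) (tg j)).
  by rewrite ip_nu mxE.
have -> : ip G nu (D_chr G D (tg i) (tg j)) =
    lin (fun c => ip G (D_chr G D (tg i) (tg j)) (bvec c)) nu.
  rewrite {1}[nu]bvec_sum ipC ip_sumr; apply: eq_bigr => c _.
  by rewrite ipZ2 mulrC.
rewrite mulrDr -linZl; under [X in _ + X]eq_lin do rewrite (ip_D_chr derD DC).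
rewrite (mulrA 2 (D N)) DN -/h; move: (anab2 G h) => B.
rewrite !linDl linNl; ring.
Qed.

Variable f : A.
Hypothesis flow : forall a b, D (ag_g G a b) = - 2 * (aricci G a b + ahess G f a b).

(* Vanishes on the boundary by the boundary condition, but not on the other leaves. *)
Definition defect : A := amean + normal_df f.

Lemma flow_asff i j : D (asff i j) =
  alapl2 L asff i j - lieX f i j - ARmTr i j - ARmTr j i + 2 * ARm i j
  - 2 * amean * Asq i j + normA2 * asff i j + nab0_riem i j
  - ahess L defect j i + defect * (Asq i j - R nu (et j) nu (et i)).
Proof.
have hE c a b := anab2_m2D G c a b flow.
apply: (half_cancel G); rewrite mulrC D_asff.
rewrite (@eq_bil _ _ _ _ _ _ flow) bilZl bilDl.
rewrite (eq_lin _ (hE (tg i) (tg j))) (eq_lin _ (hE (tg j) (tg i))).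
under [X in _ - X = _]eq_lin do rewrite hE.
have := nab_hess_total f i j; have := simons i j; rewrite /defect ahessD.
have -> : DRic (tg i) nu (et j) = DRic (tg i) (et j) nu.
  by rewrite bilC; apply: eq_bil => a b; apply: (anab2_sym G); exact: aricci_sym.
move: (anab2 G (aricci G)) (anab2 G (ahess G f)) => B1 B2 S1 S2.
rewrite !bil_bvec1 in S1 S2; rewrite !linZl !linDl (ahess_sym L amean) S1.
by apply: (eq_of_sub (congr1 (fun x => - 2 * x) S2)); ring.
Qed.

Lemma flow_metric i j : D (ag_g G (tg i) (tg j)) =
  - alie2 L (agrad L f) (ag_g L) i j
  - 2 * aricci G (tg i) (tg j) - 2 * amean * asff i j + 2 * defect * asff i j.
Proof.
rewrite flow hess_tt /defect.
by rewrite alie2_g; ring.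
Qed.

Lemma atrace_exchange (T : 'I_m -> 'I_m -> 'I_m -> 'I_m -> A) :
  atrace L (fun i j => atrace L (T i j)) = atrace L (fun k l => atrace L (fun i j => T i j k l)).
Proof.
transitivity (\sum_i \sum_j \sum_k \sum_l ghi i j * (ghi k l * T i j k l)).
  apply: eq_bigr => i _; apply: eq_bigr => j _; rewrite mulr_sumr.
  by apply: eq_bigr => k _; rewrite mulr_sumr.
rewrite exchange_sum4; apply: eq_bigr => k _; apply: eq_bigr => l _.
rewrite mulr_sumr; apply: eq_bigr => i _; rewrite mulr_sumr.
by apply: eq_bigr => j _; rewrite mulrCA.
Qed.

Lemma trace_nab0_riem : atrace L nab0_riem = nab0_ric.
Proof.
rewrite /nab0_ric -(triE (anab2 G (aricci G))) /tri.
have E i j : nab0_riem i j = lin (fun a => DR a nu (et i) nu (et j)) nu.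
  rewrite /nab0_riem -(triE (fun a b c => anab4 G _ a b _ c _)); apply: eq_lin => a.
  apply: eq_lin => b; rewrite tri_bvec1; apply: eq_lin => c.
  by rewrite lin_bvec.
under eq_atrace do rewrite E.
rewrite -lin_trace; apply: eq_lin => a.
rewrite (@frame_trace4 (anab4 G (ariem G) a)) ?DR_00 ?add0r; last exact: anab2_ricci.
apply: eq_atrace => k l.
by rewrite DR_skew12 DR_skew34 opprK.
Qed.

Lemma flow_mean : D amean =
  atrace L (ahess L amean)
  - (\sum_i \sum_j ag_g L i j * agrad L f i * agrad L amean j)
  + 2 * (\sum_i \sum_j araise2 L asff i j * aricci G (tg i) (tg j))
  + normA2 * amean + nab0_ric
  - atrace L (ahess L defect)
  - defect * (normA2 + atrace L (fun i j => R nu (et j) nu (et i))).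
Proof.
rewrite /amean (D_trace L derD) -/amean.
under eq_atrace do rewrite flow_asff lieXE.
under [X in _ - X = _]eq_bigr do under eq_bigr do
  rewrite [ag_g L _ _]/= flow_metric alie2_g.
rewrite ip_grad.
set X := sharp L (apart L f).
pose P (T : 'I_m -> 'I_m -> A) := \sum_i \sum_j araise2 L asff i j * T i j.
have -> : \sum_i \sum_j (- (2 * ahess L f i j) - 2 * aricci G (tg i) (tg j)
     - 2 * amean * asff i j + 2 * defect * asff i j) * araise2 L asff i j
  = - 2 * P (ahess L f) - 2 * P (fun i j => aricci G (tg i) (tg j))
    - 2 * amean * normA2 + 2 * defect * normA2.
  rewrite /P /normA2 !mulr_sumr -!sumrN -!big_split; apply: eq_bigr => i _ /=.
  rewrite !mulr_sumr -!sumrN -!big_split; apply: eq_bigr => j _ /=.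
  ring.
pose Q := atrace L (fun i j => lin (asff j) (cov L i X)).
have PQ : P (ahess L f) = Q.
  rewrite /P araise2_trace; apply: eq_atrace => k l.
  by rewrite -ip_cov_sharp ipC ip_sharp.
have t1 : atrace L (alapl2 L asff) = atrace L (ahess L amean).
  rewrite -[LHS]/(atrace L (fun i j => atrace L
    (fun k l => anab3 L (anab2 L asff) k l i j))) atrace_exchange.
  by apply: eq_atrace => k l; rewrite hess_trace.
have t2 : atrace L (fun i j => lin (fun k => anab2 L asff k i j) X) =
    lin (apart L amean) X.
  by rewrite -lin_trace; apply: eq_lin => k; rewrite -d_trace.
have t3 : atrace L (fun i j => lin (asff i) (cov L j X)) = Q by rewrite atraceC.
have t4 : atrace L ARmTr = atrace L ARm.
  under eq_atrace => i j do rewrite ARmTrE.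
  under [RHS]eq_atrace => i j do rewrite ARmE.
  rewrite [RHS]atrace_exchange [RHS]atraceC; apply: eq_atrace => i j.
  apply: eq_atrace => k l.
  by rewrite [LHS]R_skew12 [in LHS]R_skew34 opprK [LHS]R_pair.
have t5 : atrace L Asq = normA2 by rewrite /normA2 araise2_trace.
have t6 x : atrace L (fun i j => x * Asq i j) = x * normA2 by rewrite atraceZ t5.
rewrite -trace_nab0_riem.
rewrite PQ /P; clear PQ P; move: t1 t2 t3 t4 t5 t6.
move: (ahess L amean) (alapl2 L asff) (ahess L defect) ARmTr Asq => h1 a2 h2 rt sq.
move=> t1 t2 t3 t4 t5 t6.
rewrite !(atraceD, atraceN, atraceZ) t1 t2 t3 -/Q.
rewrite [atrace L (fun a b => h2 b a)]atraceC [atrace L (fun a b => rt b a)]atraceC.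
rewrite /= t4 t5 -[atrace L asff]/amean -[atrace L (fun a => [eta h2 a])]/(atrace L h2).
ring.
Qed.
End Flow.
End Hypersurface.

(** * One-sided directional derivatives *)

Section DirectionalDerivatives.
Context {R : realType} {V : normedModType R}.
Implicit Types (D : set V) (v x : V) (f g : V -> R).

Definition increments D v x : set_system R := within [set h | D (x + h *: v)] 0^'.

#[local] Instance increments_filter D v x : Filter (increments D v x).
Proof. exact: within_filter. Qed.

Lemma increments_D D v x : \forall h \near increments D v x, D (x + h *: v).
Proof. exact: withinT. Qed.

Lemma increments_neq0 D v x : \forall h \near increments D v x, h != 0.
Proof. exact: cvg_within (nbhs_dnbhs_neq 0). Qed.

Lemma increments_cvg0 D v x : h @[h --> increments D v x] --> (0 : R).
Proof. by move=> A /nbhs_dnbhs A0; exact: cvg_within A0. Qed.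

Lemma is_pd_ext D v f g x l : (forall y, D y -> f y = g y) -> D x ->
  is_pd D v f x l -> is_pd D v g x l.
Proof.
move=> fg Dx; apply: cvg_trans; apply: near_eq_cvg.
by near do rewrite !fg //; exact: increments_D.
Unshelve. all: by end_near. Qed.

Lemma pd_ext D v f g x : (forall y, D y -> f y = g y) -> D x -> pd D v f x = pd D v g x.
Proof.
move=> fg Dx; rewrite /pd; congr (lim _).
have FF := increments_filter D v x.
apply/seteqP; split; rewrite /dquot -/(increments D v x).
  by apply: near_eq_cvg; near do rewrite !fg //; exact: increments_D.
by apply: near_eq_cvg; near do rewrite !fg //; exact: increments_D.
Unshelve. all: by end_near. Qed.

Lemma is_pd_cst D v (c : R) x : is_pd D v (fun=> c) x 0.
Proof.
rewrite /is_pd /dquot.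
under eq_cvg do rewrite subrr mulr0.
exact: cvg_cst.
Qed.

Lemma is_pdD D v f g x l k : is_pd D v f x l -> is_pd D v g x k ->
  is_pd D v (fun y => f y + g y) x (l + k).
Proof.
move=> fl gk; rewrite /is_pd /dquot.
under eq_cvg do rewrite opprD addrACA mulrDr.
exact: (cvgD fl gk).
Qed.

Lemma is_pd_continuous D v f x l : is_pd D v f x l ->
  f (x + h *: v) @[h --> increments D v x] --> f x.
Proof.
move=> fl; have : (h * (h^-1 * (f (x + h *: v) - f x)) + f x)
    @[h --> increments D v x] --> 0 * l + f x.
  by apply: cvgD; [apply: cvgM => //; exact: increments_cvg0|exact: cvg_cst].
rewrite mul0r add0r; apply: cvg_trans; apply: near_eq_cvg; near=> h.
rewrite /= mulrA mulfV ?mul1r ?subrK //; near: h; exact: increments_neq0.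
Unshelve. all: by end_near. Qed.

(* [psi] is the difference quotient of [phi] from the base point [f x]. *)
Lemma is_pd_comp D v f (phi : R -> R) (psi : R -> R) x l : D x ->
  (forall y, D y -> phi (f y) - phi (f x) = (f y - f x) * psi (f y)) ->
  {for f x, continuous psi} -> is_pd D v f x l ->
  is_pd D v (phi \o f) x (l * psi (f x)).
Proof.
move=> Dx E cpsi fl.
have : ((h^-1 * (f (x + h *: v) - f x)) * psi (f (x + h *: v)))
    @[h --> increments D v x] --> l * psi (f x).
  by apply: cvgM => //; apply: continuous_cvg cpsi (is_pd_continuous fl).
apply: cvg_trans; apply: near_eq_cvg; near=> h => /=.
rewrite E ?mulrA //; near: h; exact: increments_D.
Unshelve. all: by end_near. Qed.

Lemma is_pdM D v f g x l k : is_pd D v f x l -> is_pd D v g x k ->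
  is_pd D v (fun y => f y * g y) x (l * g x + f x * k).
Proof.
move=> fl gk.
have : ((h^-1 * (f (x + h *: v) - f x)) * g (x + h *: v)
    + f x * (h^-1 * (g (x + h *: v) - g x))) @[h --> increments D v x]
    --> l * g x + f x * k.
  apply: cvgD; first by apply: cvgM => //; exact: is_pd_continuous gk.
  by apply: cvgM => //; exact: cvg_cst.
apply: cvg_trans; apply: near_eq_cvg; near=> h => /=; ring.
Unshelve. all: by end_near. Qed.

Lemma is_pdV D v f x l : D x -> (forall y, D y -> f y != 0) -> is_pd D v f x l ->
  is_pd D v (fun y => (f y)^-1) x (l * - ((f x)^-1 * (f x)^-1)).
Proof.
move=> Dx f0 fl; apply: (@is_pd_comp _ _ _ _ (fun u => - (u^-1 * (f x)^-1))) fl => //.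
  by move=> y Dy; field; rewrite !f0.
apply: cvgN; apply: cvgMr_tmp; apply: cvgV; [exact: f0|exact: cvg_id].
Qed.

Lemma is_pd_sqrt D v f x l : D x -> (forall y, D y -> 0 < f y) -> is_pd D v f x l ->
  is_pd D v (fun y => Num.sqrt (f y)) x
    (l * (Num.sqrt (f x) + Num.sqrt (f x))^-1).
Proof.
move=> Dx f0 fl.
have s0 y : D y -> 0 < Num.sqrt (f y) by move=> Dy; rewrite sqrtr_gt0 f0.
apply: (@is_pd_comp _ _ _ _ (fun u => (Num.sqrt u + Num.sqrt (f x))^-1)) fl => //.
  move=> y Dy.
  have -> : f y - f x = Num.sqrt (f y) ^+ 2 - Num.sqrt (f x) ^+ 2.
    by rewrite !sqr_sqrtr // ltW // f0.
  by field; rewrite gt_eqF // addr_gt0 // s0.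
apply: cvgV; first by rewrite gt_eqF // addr_gt0 // s0.
by apply: cvgD; [exact: sqrt_continuous|exact: cvg_cst].
Qed.

Lemma is_pd_scale D v (s : R) f x l : s != 0 -> is_pd D v f x l ->
  is_pd D (s *: v) f x (s * l).
Proof.
move=> s0 fl.
have sF : h * s @[h --> increments D (s *: v) x] --> increments D v x.
  move=> A A0; have c : h * s @[h --> (0 : R)] --> 0 * s.
    by apply: cvgMr_tmp; exact: cvg_id.
  rewrite mul0r in c.
  rewrite -[_ _]/(nbhs (0 : R) (fun h => h != 0 -> D (x + h *: (s *: v)) -> A (h * s))).
  have H : nbhs (0 : R) (fun h => h * s != 0 -> D (x + (h * s) *: v) -> A (h * s)).
    exact: c (fun k => k != 0 -> D (x + k *: v) -> A k) A0.
  apply: filterS H => h /= AS hn0.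
  by rewrite scalerA; apply: AS; rewrite mulf_neq0.
have : s * ((h * s)^-1 * (f (x + (h * s) *: v) - f x))
    @[h --> increments D (s *: v) x] --> s * l.
  by apply: cvgMl_tmp; exact: cvg_comp sF fl.
apply: cvg_trans; apply: near_eq_cvg; near=> h => /=.
rewrite scalerA invfM; field; rewrite s0 andbT /=; near: h; exact: increments_neq0.
Unshelve. all: by end_near. Qed.

Lemma segment_is_derive D u g y r s l :
  (forall t, 0 <= t <= r -> D (y + t *: u)) -> 0 < s < r ->
  is_pd D u g (y + s *: u) l -> is_derive s 1 (fun t => g (y + t *: u)) l.
Proof.
move=> segD /andP[s0 sr] gl.
have nearD : \forall h \near (0 : R), 0 <= s + h <= r.
  have n1 : \forall h \near (0 : R), `|h| < s := nbhs0_lt s0.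
  have n2 : \forall h \near (0 : R), `|h| < r - s.
    by apply: nbhs0_lt; rewrite subr_gt0.
  apply: filterS2 n1 n2 => h; rewrite !ltr_norml => /andP[a b] /andP[c e].
  by apply/andP; split; lra.
have L : h^-1 *: (((fun t => g (y + t *: u)) \o shift s) (h *: 1) - g (y + s *: u))
    @[h --> 0^'] --> l.
  move=> A /gl H.
  have H' : \forall h \near 0^', D (y + s *: u + h *: u) ->
      A (h^-1 * (g (y + s *: u + h *: u) - g (y + s *: u))) by exact: H.
  have := filterS2 _ _ H' (nbhs_dnbhs nearD).
  apply => h /= HA Dh; have h1 : h *: (1 : R) = h by exact: mulr1.
  rewrite h1; have E : y + s *: u + h *: u = y + (h + s) *: u.
    by rewrite -addrA -scalerDl [s + h]addrC.
  rewrite -E; apply: HA; rewrite E; apply: segD.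
  by rewrite addrC.
split; first exact: cvgP L.
exact: cvg_lim L.
Qed.

Lemma segment_continuous D u g y r :
  (forall t, 0 <= t <= r -> D (y + t *: u)) -> {within D, continuous g} ->
  {within `[0, r], continuous (fun t => g (y + t *: u))}.
Proof.
move=> segD /subspace_continuousP cg; apply/subspace_continuousP => t /=.
rewrite in_itv /= => /segD Dt A /(cg _ Dt) H.
have c : y + t' *: u @[t' --> t] --> y + t *: u.
  by apply: cvgD; [exact: cvg_cst|apply: cvgZr_tmp; exact: cvg_id].
have H' : \forall t' \near t, D (y + t' *: u) -> A (g (y + t' *: u)) by exact: c _ H.
by apply: filterS H' => t' AD; rewrite /= in_itv /= => /segD.
Qed.

Lemma schwarz_half D f fu fzu u z x r h :
  (forall s t, 0 <= s <= r -> 0 <= t <= r -> D (x + s *: u + t *: z)) ->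
  (forall y, D y -> is_pd D u f y (fu y)) -> (forall y, D y -> is_pd D z fu y (fzu y)) ->
  {within D, continuous f} -> {within D, continuous fu} -> 0 < h <= r ->
  exists s t, [/\ 0 <= s <= h, 0 <= t <= h &
    f (x + h *: u + h *: z) - f (x + h *: u) - f (x + h *: z) + f x =
      h * h * fzu (x + s *: u + t *: z)].
Proof.
move=> corner df dfu cf cfu /andP[h0 hr].
have D1 t : 0 <= t <= h -> D (x + t *: u).
  move=> /andP[t0 th]; rewrite -[X in D X]addr0 -(scale0r z).
  by apply: corner; rewrite ?lexx ?t0 ?(le_trans th hr) // ltW // (lt_le_trans h0).
have D2 t : 0 <= t <= h -> D (x + h *: z + t *: u).
  by move=> /andP[t0 th]; rewrite addrAC; apply: corner; rewrite ?(ltW h0) ?hr ?t0 ?(le_trans th hr).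
have der1 s : s \in `]0, h[ -> is_derive s 1
    (fun s => f (x + h *: z + s *: u) - f (x + s *: u))
    (fu (x + h *: z + s *: u) - fu (x + s *: u)).
  rewrite in_itv /= => sI; have sI' : 0 <= s <= h by case/andP: sI => ? ?; rewrite !ltW.
  by apply: is_deriveB; [apply: (segment_is_derive D2 sI); exact/df/D2
                        |apply: (segment_is_derive D1 sI); exact/df/D1].
have cont1 : {within `[0, h], continuous
    (fun s => f (x + h *: z + s *: u) - f (x + s *: u))}.
  move=> s; apply: cvgB; first exact: (segment_continuous D2 cf).
  exact: (segment_continuous D1 cf).
have [s sI E1] := MVT h0 der1 cont1.
have {}sI : 0 <= s <= h by move: sI; rewrite in_itv /= => /andP[? ?]; rewrite !ltW.
have D3 t : 0 <= t <= h -> D (x + s *: u + t *: z).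
  case/andP: sI => s0 sh /andP[t0 th].
  by apply: corner; rewrite ?s0 ?t0 /= ?(le_trans _ hr).
have der2 t : t \in `]0, h[ -> is_derive t 1
    (fun t => fu (x + s *: u + t *: z)) (fzu (x + s *: u + t *: z)).
  rewrite in_itv /= => tI; have tI' : 0 <= t <= h by case/andP: tI => ? ?; rewrite !ltW.
  by apply: (segment_is_derive D3 tI); exact/dfu/D3.
have [t tI E2] := MVT h0 der2 (segment_continuous D3 cfu).
have {}tI : 0 <= t <= h by move: tI; rewrite in_itv /= => /andP[? ?]; rewrite !ltW.
exists s, t; split => //.
move: E1 E2; rewrite !scale0r !addr0 subr0 => E1 E2.
rewrite (addrAC x (s *: u)) in E2; rewrite E2 in E1; rewrite [x + h *: u + h *: z]addrAC.
by apply: (eq_of_sub E1); ring.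
Qed.

Lemma schwarz D f fu fz fuz fzu u z x r : 0 < r ->
  (forall s t, 0 <= s <= r -> 0 <= t <= r -> D (x + s *: u + t *: z)) ->
  (forall y, D y -> is_pd D u f y (fu y)) -> (forall y, D y -> is_pd D z f y (fz y)) ->
  (forall y, D y -> is_pd D z fu y (fzu y)) -> (forall y, D y -> is_pd D u fz y (fuz y)) ->
  {within D, continuous f} -> {within D, continuous fu} -> {within D, continuous fz} ->
  {within D, continuous fzu} -> {within D, continuous fuz} -> fzu x = fuz x.
Proof.
move=> r0 corner dfu dfz dfzu dfuz cf cfu cfz cfzu cfuz.
have corner' s t : 0 <= s <= r -> 0 <= t <= r -> D (x + s *: z + t *: u).
  by move=> sr tr; rewrite addrAC; exact: corner.
have Dx : D x.
  have := corner 0 0; rewrite !scale0r !addr0; apply; by rewrite lexx ltW.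
apply/eqP; rewrite -subr_eq0 -normr_le0; apply/ler_addgt0Pr => e e0; rewrite add0r.
have e2 : 0 < e / 2 by rewrite divr_gt0.
move/subspace_continuousP: cfzu => /(_ x Dx) /cvgr_dist_lt /(_ _ e2) n1.
move/subspace_continuousP: cfuz => /(_ x Dx) /cvgr_dist_lt /(_ _ e2) n2.
have : nbhs x (fun y => D y -> `|fzu x - fzu y| < e / 2) by exact: n1.
have : nbhs x (fun y => D y -> `|fuz x - fuz y| < e / 2) by exact: n2.
move=> /nbhs_ballP[d2 /= d20 b2] /nbhs_ballP[d1 /= d10 b1].
pose K := `|u| + `|z| + 1; have K0 : 0 < K by rewrite ltr_wpDl // addr_ge0.
pose d := Num.min d1 d2; have d0 : 0 < d by rewrite lt_min d10.
pose h := Num.min r (d / (2 * K)).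
have h0 : 0 < h by rewrite lt_min r0 divr_gt0 // mulr_gt0.
have hr : 0 < h <= r by rewrite h0 ge_min lexx.
have hK : h * K < d.
  apply: (@le_lt_trans _ _ (d / 2)); last by lra.
  rewrite (@le_trans _ _ (d / (2 * K) * K)) //.
    by rewrite ler_pM2r // ge_min lexx orbT.
  by rewrite le_eqVlt; apply/orP; left; apply/eqP; field; rewrite gt_eqF.
have near s t : 0 <= s <= h -> 0 <= t <= h -> ball x d (x + s *: u + t *: z).
  move=> /andP[s0 sh] /andP[t0 th]; rewrite -ball_normE /= -addrA opprD addrA subrr add0r normrN.
  apply: le_lt_trans hK; apply: (le_trans (ler_normD _ _)); rewrite !normrZ !ger0_norm //.
  rewrite /K !mulrDr mulr1 (@le_trans _ _ (h * `|u| + h * `|z|)) ?lerDl ?(ltW h0) //.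
  by apply: lerD; apply: ler_wpM2r.
have [s [t [sh th E1]]] := schwarz_half corner dfu dfzu cf cfu hr.
have [s' [t' [sh' th' E2]]] := schwarz_half corner' dfz dfuz cf cfz hr.
have wr w : 0 <= w <= h -> 0 <= w <= r.
  by move=> /andP[-> wh]; rewrite (le_trans wh) //; case/andP: hr.
have E : fzu (x + s *: u + t *: z) = fuz (x + s' *: z + t' *: u).
  apply: (@mulfI _ (h * h)); first by rewrite mulf_neq0 // gt_eqF.
  by rewrite -E1 -E2 [x + h *: z + h *: u]addrAC; ring.
have dd1 : d <= d1 by rewrite ge_min lexx.
have dd2 : d <= d2 by rewrite ge_min lexx orbT.
have C1 := b1 _ (le_ball dd1 (near s t sh th)) (corner _ _ (wr _ sh) (wr _ th)).
have := b2 _ (le_ball dd2 (near t' s' th' sh')) (corner _ _ (wr _ th') (wr _ sh')).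
rewrite [x + t' *: u + _]addrAC -E => C2.
have -> : fzu x - fuz x = (fzu x - fzu (x + s *: u + t *: z))
   - (fuz x - fzu (x + s *: u + t *: z)) by ring.
apply: (le_trans (ler_normB _ _)); lra.
Qed.

End DirectionalDerivatives.

Lemma dquot_pullback {R : realType} {U V : normedModType R} (D : set V) (D' : set U)
    (p : U -> V) (u : U) (v : V) (a : V -> R) (x : U) :
  (forall y, D' y = D (p y)) -> (forall h : R, p (x + h *: u) = p x + h *: v) ->
  dquot D' u (a \o p) x = dquot D v a (p x).
Proof.
move=> DD pE; rewrite /dquot.
have -> : [set h | D' (x + h *: u)] = [set h | D (p x + h *: v)].
  by apply/seteqP; split => h /=; rewrite DD pE.
have -> // : (fun h => h^-1 * ((a \o p) (x + h *: u) - (a \o p) x)) =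
  (fun h => h^-1 * (a (p x + h *: v) - a (p x))).
by apply: funext => h /=; rewrite pE.
Qed.

(** * The ring of smooth functions *)

(* [cd_corner]: near each of its points, a coordinate domain contains a small
   rectangle in any two coordinate directions, up to the choice of signs; this is
   what survives of openness at boundary points. *)
Record cdomain (R : realType) (V : normedModType R) := CDomain {
  cd_set : set V;
  cd_dirs : set V;
  cd_corner : forall x v w, cd_set x -> cd_dirs v -> cd_dirs w ->
    exists a b r, [/\ a != 0, b != 0, 0 < r & forall s t : R,
      0 <= s <= r -> 0 <= t <= r -> cd_set (x + s *: (a *: v) + t *: (b *: w))] }.

Section SmoothFunctions.
Context {R : realType} {V : normedModType R} (W : cdomain V).
Local Notation D := (cd_set W).
Local Notation B := (cd_dirs W).
Implicit Types f g : V -> R.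

Lemma increments_proper v x : D x -> B v -> ProperFilter (increments D v x).
Proof.
move=> Dx Bv; apply: Build_ProperFilter_ex => A HA.
have [a [b [r [a0 b0 r0 corner]]]] := cd_corner Dx Bv Bv.
have : nbhs (0 : R) (fun h => h != 0 -> D (x + h *: v) -> A h) by exact: HA.
move=> /nbhs_ballP[e /= e0 He].
have na : 0 < `|a| by rewrite normr_gt0.
pose s := Num.min r (e / (2 * `|a|)).
have s0 : 0 < s by rewrite lt_min r0 divr_gt0 // mulr_gt0.
exists (s * a); apply: He.
- rewrite -ball_normE /= sub0r normrN normrM (gtr0_norm s0).
  apply: (@le_lt_trans _ _ (e / 2)); last by lra.
  rewrite (@le_trans _ _ (e / (2 * `|a|) * `|a|)) //.
    by rewrite ler_pM2r // ge_min lexx orbT.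
  by rewrite le_eqVlt; apply/orP; left; apply/eqP; field; rewrite gt_eqF.
- by rewrite mulf_neq0 // gt_eqF.
- have := corner s 0; rewrite scale0r addr0 scalerA; apply.
    by rewrite ltW //= ge_min lexx.
  by rewrite lexx ltW.
Qed.

Lemma pdE v f x l : D x -> B v -> is_pd D v f x l -> pd D v f x = l.
Proof.
move=> Dx Bv; have := increments_proper Dx Bv => ?.
exact: cvg_lim.
Qed.

(* Closing the smooth functions under these operations gives a class that is stable
   under [pd], hence consists of smooth functions. *)
Inductive algebraic : (V -> R) -> Prop :=
| AlgSmooth f : smooth_on B D f -> algebraic f
| AlgConst c : algebraic (fun=> c)
| AlgAdd f g : algebraic f -> algebraic g -> algebraic (fun y => f y + g y)
| AlgMul f g : algebraic f -> algebraic g -> algebraic (fun y => f y * g y)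
| AlgInv f : algebraic f -> (forall y, D y -> f y != 0) -> algebraic (fun y => (f y)^-1)
| AlgSqrt f : algebraic f -> (forall y, D y -> 0 < f y) ->
    algebraic (fun y => Num.sqrt (f y))
| AlgExt f g : algebraic f -> (forall y, D y -> f y = g y) -> algebraic g.

Lemma algebraic_continuous f : algebraic f -> {within D, continuous f}.
Proof.
move=> af; apply/subspace_continuousP => x Dx.
have FF : Filter (within D (nbhs x)) by exact: within_filter.
elim: af => {f} [f sf|c|f g _ cf _ cg|f g _ cf _ cg|f _ cf f0|f _ cf f0|f g _ cf fg].
- have [//|/subspace_continuousP cf _] := sf [::]; exact: cf.
- exact: cvg_cst.
- exact: cvgD.
- exact: cvgM.
- by apply: cvgV => //; exact: f0.
- by apply: continuous_cvg cf; exact: sqrt_continuous.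
- change (g y @[y --> within D (nbhs x)] --> g x); rewrite -(fg x Dx).
  apply: cvg_trans cf; apply: near_eq_cvg; near=> y; apply: fg.
  by near: y; exact: withinT.
Unshelve. all: by end_near. Qed.

Lemma algebraic_pd v f : B v -> algebraic f ->
  exists2 f', algebraic f' & forall x, D x -> is_pd D v f x (f' x).
Proof.
move=> Bv; elim => {f} [f sf|c|f g _ [f' af' df] _ [g' ag' dg]
  |f g af [f' af' df] ag [g' ag' dg]|f af [f' af' df] f0|f af [f' af' df] f0
  |f g _ [f' af' df] fg].
- exists (pd D v f); last first.
    move=> x Dx; have [//|_ H] := sf [::].
    exact: H.
  apply: AlgSmooth => vs Bvs; have := sf (rcons vs v); rewrite /pds foldr_rcons; apply.
  by move=> w; rewrite mem_rcons inE => /orP[/eqP ->|/Bvs].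
- by exists (fun=> 0); [exact: AlgConst|move=> x _; exact: is_pd_cst].
- by exists (fun y => f' y + g' y); [exact: AlgAdd|move=> x Dx; apply: is_pdD; auto].
- exists (fun y => f' y * g y + f y * g' y); last by move=> x Dx; apply: is_pdM; auto.
  by apply: AlgAdd; exact: AlgMul.
- exists (fun y => f' y * (-1 * ((f y)^-1 * (f y)^-1))); last first.
    by move=> x Dx; rewrite mulN1r; apply: is_pdV; auto.
  by do 3?apply: AlgMul => //; [exact: AlgConst|exact: AlgInv|exact: AlgInv].
- exists (fun y => f' y * (Num.sqrt (f y) + Num.sqrt (f y))^-1); last first.
    by move=> x Dx; apply: is_pd_sqrt; auto.
  apply: AlgMul => //; apply: AlgInv; first by apply: AlgAdd; exact: AlgSqrt.
  by move=> y Dy; rewrite gt_eqF // addr_gt0 // sqrtr_gt0 f0.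
- by exists f' => // x Dx; apply: (is_pd_ext fg) => //; exact: df.
Qed.

Lemma algebraic_smooth f : algebraic f -> smooth_on B D f.
Proof.
move=> af vs Bvs.
have [g ag gE] : exists2 g, algebraic g & forall x, D x -> pds D vs f x = g x.
  elim: vs Bvs => [|v vs IH] Bvs; first by exists f.
  have [|g ag gE] := IH; first by move=> w wv; apply: Bvs; rewrite inE wv orbT.
  have Bv : B v by apply: Bvs; rewrite inE eqxx.
  have [g' ag' dg] := algebraic_pd Bv ag; exists g' => // x Dx.
  by rewrite /= (pd_ext _ gE Dx); apply: pdE => //; exact: dg.
have ap : algebraic (pds D vs f) by apply: AlgExt ag _ => x /gE.
split; first exact: algebraic_continuous.
move=> v x Bv Dx; have [h _ dh] := algebraic_pd Bv ap.
exact: cvgP (dh _ Dx).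
Qed.

End SmoothFunctions.

(* Values outside the domain are normalised to 0, so that equality of smooth
   functions is equality on the domain. *)
Record sfun (R : realType) (V : normedModType R) (W : cdomain V) := SFun {
  sf_val :> V -> R;
  sf_smooth : smooth_on (cd_dirs W) (cd_set W) sf_val;
  sf_out : forall x, ~ cd_set W x -> sf_val x = 0 }.

Section SmoothRing.
Context {R : realType} {V : normedModType R} {W : cdomain V}.
Local Notation D := (cd_set W).
Local Notation B := (cd_dirs W).
Local Notation A := (sfun W).

Definition trim (f : V -> R) : V -> R := fun x => if `[< D x >] then f x else 0.

Lemma trimE f x : D x -> trim f x = f x.
Proof. by move=> Dx; rewrite /trim asboolT. Qed.

Lemma trim_smooth f : algebraic W f -> smooth_on B D (trim f).
Proof. by move=> af; apply: algebraic_smooth; apply: AlgExt af _ => y /trimE. Qed.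

Lemma trim_out f x : ~ D x -> trim f x = 0.
Proof. by move=> Dx; rewrite /trim asboolF. Qed.

Definition mk_sfun f (af : algebraic W f) : A := SFun (trim_smooth af) (@trim_out f).

Lemma mk_sfunE f (af : algebraic W f) x : D x -> mk_sfun af x = f x.
Proof. exact: trimE. Qed.

Lemma sfun_algebraic (a : A) : algebraic W a.
Proof. exact: AlgSmooth (sf_smooth a). Qed.
Local Notation alg := sfun_algebraic.

Lemma sfun_eq (a b : A) : (forall x, D x -> a x = b x) -> a = b.
Proof.
case: a b => [f sf f0] [g sg g0] /= E.
have {}E : f = g.
  by apply/funext => x; have [/E//|Dx] := pselect (D x); rewrite f0 // g0.
by case: _ / E in sg g0 *; congr SFun; exact: Prop_irrelevance.
Qed.

HB.instance Definition _ := gen_eqMixin A.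
HB.instance Definition _ := gen_choiceMixin A.

Definition sf_cst (c : R) : A := mk_sfun (AlgConst W c).
Definition sf_add (a b : A) : A := mk_sfun (AlgAdd (alg a) (alg b)).
Definition sf_mul (a b : A) : A := mk_sfun (AlgMul (alg a) (alg b)).
Definition sf_opp (a : A) : A := sf_mul (sf_cst (-1)) a.

Let cstE c x : D x -> sf_cst c x = c. Proof. exact: mk_sfunE. Qed.
Let addE a b x : D x -> sf_add a b x = a x + b x. Proof. exact: mk_sfunE. Qed.
Let mulE a b x : D x -> sf_mul a b x = a x * b x. Proof. exact: mk_sfunE. Qed.
Let oppE a x : D x -> sf_opp a x = - a x.
Proof. by move=> Dx; rewrite mulE // cstE // mulN1r. Qed.
Let sE := (cstE, addE, mulE, oppE).

Lemma sf_addA : associative sf_add.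
Proof. by move=> a b c; apply: sfun_eq => x Dx; rewrite !sE // addrA. Qed.
Lemma sf_addC : commutative sf_add.
Proof. by move=> a b; apply: sfun_eq => x Dx; rewrite !sE // addrC. Qed.
Lemma sf_add0 : left_id (sf_cst 0) sf_add.
Proof. by move=> a; apply: sfun_eq => x Dx; rewrite !sE // add0r. Qed.
Lemma sf_addN : left_inverse (sf_cst 0) sf_opp sf_add.
Proof. by move=> a; apply: sfun_eq => x Dx; rewrite !sE // addNr. Qed.
HB.instance Definition _ := GRing.isZmodule.Build A sf_addA sf_addC sf_add0 sf_addN.

Lemma sf_mulA : associative sf_mul.
Proof. by move=> a b c; apply: sfun_eq => x Dx; rewrite !sE // mulrA. Qed.
Lemma sf_mulC : commutative sf_mul.
Proof. by move=> a b; apply: sfun_eq => x Dx; rewrite !sE // mulrC. Qed.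
Lemma sf_mul1 : left_id (sf_cst 1) sf_mul.
Proof. by move=> a; apply: sfun_eq => x Dx; rewrite !sE // mul1r. Qed.
Lemma sf_mulDl : left_distributive sf_mul +%R.
Proof.
move=> a b c; rewrite -[a + b]/(sf_add a b) -[_ + _]/(sf_add _ _).
by apply: sfun_eq => x Dx; rewrite !sE // mulrDl.
Qed.
HB.instance Definition _ :=
  GRing.Zmodule_isComPzRing.Build A sf_mulA sf_mulC sf_mul1 sf_mulDl.

(* The proof of [D x] makes evaluation a ring morphism. *)
Definition eval x (Dx : D x) (a : A) : R := a x.

Section Eval.
Variables (x : V) (Dx : D x).
Lemma eval_is_zmod : zmod_morphism (eval Dx).
Proof. by move=> a b; rewrite /eval [LHS]addE // oppE. Qed.
HB.instance Definition _ := GRing.isZmodMorphism.Build A R (eval Dx) eval_is_zmod.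
Lemma eval_is_monoid : monoid_morphism (eval Dx).
Proof. by split=> [|a b]; [exact: cstE|exact: mulE]. Qed.
HB.instance Definition _ := GRing.isMonoidMorphism.Build A R (eval Dx) eval_is_monoid.
End Eval.

Lemma eval_cst x (Dx : D x) c : eval Dx (sf_cst c) = c. Proof. exact: cstE. Qed.

Section EvalTheory.
Variables (x : V) (Dx : D x).
Local Notation E := (eval Dx).
Lemma evalD a b : E (a + b) = E a + E b. Proof. exact: rmorphD. Qed.
Lemma evalN a : E (- a) = - E a. Proof. exact: rmorphN. Qed.
Lemma evalB a b : E (a - b) = E a - E b. Proof. exact: rmorphB. Qed.
Lemma evalM a b : E (a * b) = E a * E b. Proof. exact: rmorphM. Qed.
Lemma eval_nat k : E k%:R = k%:R. Proof. exact: rmorph_nat. Qed.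
Lemma eval1 : E 1 = 1. Proof. exact: rmorph1. Qed.
Lemma eval_sum (I : finType) (F : I -> A) : E (\sum_i F i) = \sum_i E (F i).
Proof. exact: rmorph_sum. Qed.
End EvalTheory.

Lemma eval_eq (a b : A) : (forall x (Dx : D x), eval Dx a = eval Dx b) -> a = b.
Proof. by move=> E; apply: sfun_eq => x Dx; exact: E. Qed.

Lemma sfun_inv (a : A) : (forall x (Dx : D x), eval Dx a != 0) -> exists b, a * b = 1.
Proof.
move=> a0; exists (mk_sfun (AlgInv (alg a) a0)); apply: eval_eq => x Dx.
by rewrite rmorphM rmorph1 [X in _ * X]mk_sfunE // mulfV // a0.
Qed.

Lemma sfun_sqrt (a : A) : (forall x (Dx : D x), 0 < eval Dx a) ->
  exists2 b, b * b = a & forall x (Dx : D x), 0 < eval Dx b.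
Proof.
move=> a0; exists (mk_sfun (AlgSqrt (alg a) a0)).
  apply: eval_eq => x Dx; rewrite rmorphM [X in X * _]mk_sfunE //.
  by rewrite [X in _ * X]mk_sfunE // -expr2 sqr_sqrtr // ltW // a0.
by move=> x Dx; rewrite /eval mk_sfunE // sqrtr_gt0 a0.
Qed.

Section Diff.
Variables (v : V) (Bv : B v).

Lemma pd_algebraic (a : A) : algebraic W (pd D v a).
Proof.
have [g ag gE] := algebraic_pd Bv (alg a).
by apply: AlgExt ag _ => x Dx; rewrite (pdE Dx Bv (gE _ Dx)).
Qed.

Definition diff (a : A) : A := mk_sfun (pd_algebraic a).

Lemma is_pd_diff (a : A) x : D x -> is_pd D v a x (diff a x).
Proof.
move=> Dx; have [g ag gE] := algebraic_pd Bv (alg a).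
by rewrite mk_sfunE // (pdE Dx Bv (gE _ Dx)); exact: gE.
Qed.

Lemma diff_derivation : derivation diff.
Proof.
split=> a b; apply: sfun_eq => x Dx.
  have E y : D y -> a y + b y = (a + b) y by move=> Dy; rewrite addE.
  rewrite [RHS]addE // mk_sfunE //; apply: (pdE Dx Bv).
  exact: is_pd_ext E Dx (is_pdD (@is_pd_diff a x Dx) (@is_pd_diff b x Dx)).
have E y : D y -> a y * b y = (a * b) y by move=> Dy; rewrite mulE.
rewrite [RHS]addE // !mulE // mk_sfunE //; apply: (pdE Dx Bv).
exact: is_pd_ext E Dx (is_pdM (@is_pd_diff a x Dx) (@is_pd_diff b x Dx)).
Qed.

End Diff.

Lemma diff_comm v w (Bv : B v) (Bw : B w) a : diff Bv (diff Bw a) = diff Bw (diff Bv a).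
Proof.
apply: sfun_eq => x Dx.
have [s [t [r [s0 t0 r0 corner]]]] := cd_corner Dx Bv Bw.
have sc u (Bu : B u) (c : R) (b : A) : c != 0 -> forall y, D y -> is_pd D (c *: u) b y (c * diff Bu b y).
  by move=> c0 y Dy; apply: is_pd_scale => //; exact: is_pd_diff.
have cont (b : A) (c : R) : {within D, continuous (fun y => c * b y)}.
  by apply: algebraic_continuous; apply: AlgMul; [exact: AlgConst|exact: alg].
have scM u (Bu : B u) (c e : R) (b : A) : c != 0 -> forall y, D y ->
    is_pd D (c *: u) (fun z => e * b z) y (e * c * diff Bu b y).
  move=> c0 y Dy; have := is_pdM (is_pd_cst D (c *: u) e y) (sc u Bu c b c0 y Dy).
  by rewrite mul0r add0r mulrA.
have E := schwarz r0 corner (sc _ Bv _ _ s0) (sc _ Bw _ _ t0) (scM _ Bw _ s _ t0)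
  (scM _ Bv _ t _ s0) _ (cont _ _) (cont _ _) (cont _ _) (cont _ _).
apply: (@mulfI _ (t * s)); first by rewrite mulf_neq0.
rewrite {2}[t * s]mulrC -E //; apply: algebraic_continuous; exact: alg.
Qed.

End SmoothRing.

(** * Geometry of charts *)

Section Representation.
Context {R : realType} {V : normedModType R} (W : cdomain V) {n : nat}.
Variables (G : ageom (sfun W) n) (D : set 'rV[R]_n) (p : 'rV[R]_n -> V).
Hypothesis Dp : forall x, D x -> cd_set W (p x).
Variable M : 'rV[R]_n -> 'M[R]_n.
Local Notation A := (sfun W).
Local Notation E Dx := (eval (Dp Dx)).

Definition represents (a : A) (phi : 'rV[R]_n -> R) : Prop :=
  forall x (Dx : D x), phi x = E Dx a.

Hypothesis pdE : forall i (a : A) x (Dx : D x),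
  pd D (ebase i) (fun y => a (p y)) x = E Dx (ag_d G i a).
Hypothesis halfE : forall x (Dx : D x), E Dx (ag_half G) = 2^-1.
Hypothesis gE : forall i j, represents (ag_g G i j) (gdn M i j).
Hypothesis giE : forall i j, represents (ag_gi G i j) (gup M i j).

Lemma represents_pd i a phi : represents a phi ->
  represents (ag_d G i a) (pd D (ebase i) phi).
Proof.
move=> aphi x Dx; rewrite -pdE; apply: pd_ext Dx => y Dy; exact: aphi.
Qed.

Lemma represents_christoffel k i j :
  represents (achr G k i j) (christoffel D M k i j).
Proof.
move=> x Dx; rewrite /achr evalM halfE eval_sum; congr (_ * _).
apply: eq_bigr => l _; rewrite evalM evalB evalD -giE; congr (_ * (_ + _ - _));
  exact: represents_pd.
Qed.
Local Notation rchr := represents_christoffel.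

Lemma represents_nabla1 T T' k i : (forall i, represents (T i) (T' i)) ->
  represents (anab1 G T k i) (nabla1 D M T' k i).
Proof.
move=> TT x Dx; rewrite /anab1 evalB eval_sum; congr (_ - _).
  exact: represents_pd.
by apply: eq_bigr => l _; rewrite evalM -rchr -TT.
Qed.

Lemma represents_nabla2 T T' k i j : (forall i j, represents (T i j) (T' i j)) ->
  represents (anab2 G T k i j) (nabla2 D M T' k i j).
Proof.
move=> TT x Dx; rewrite /anab2 !evalB !eval_sum; congr (_ - _ - _);
  try by apply: eq_bigr => l _; rewrite evalM -rchr -TT.
exact: represents_pd.
Qed.

Lemma represents_nabla3 T T' k i j q : (forall i j q, represents (T i j q) (T' i j q)) ->
  represents (anab3 G T k i j q) (nabla3 D M T' k i j q).
Proof.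
move=> TT x Dx; rewrite /anab3 !evalB !eval_sum; congr (_ - _ - _ - _);
  try by apply: eq_bigr => l _; rewrite evalM -rchr -TT.
exact: represents_pd.
Qed.

Lemma represents_nabla4 T T' k i j q s :
  (forall i j q s, represents (T i j q s) (T' i j q s)) ->
  represents (anab4 G T k i j q s) (nabla4 D M T' k i j q s).
Proof.
move=> TT x Dx; rewrite /anab4 !evalB !eval_sum; congr (_ - _ - _ - _ - _);
  try by apply: eq_bigr => l _; rewrite evalM -rchr -TT.
exact: represents_pd.
Qed.

Lemma represents_riemann_up a b c e :
  represents (ariem_up G a b c e) (riemann_up D M a b c e).
Proof.
move=> x Dx; rewrite /ariem_up evalD evalB eval_sum; congr (_ - _ + _);
  try exact/represents_pd/rchr.
apply: eq_bigr => l _; rewrite evalB (evalM _ (achr G a c l)) (evalM _ (achr G a e l)).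
by congr (_ * _ - _ * _); exact: rchr.
Qed.

Lemma represents_riemann a b c e : represents (ariem G a b c e) (riemann D M a b c e).
Proof.
move=> x Dx; rewrite /ariem eval_sum; apply: eq_bigr => l _.
by rewrite evalM -gE -represents_riemann_up.
Qed.

Lemma represents_ricci b e : represents (aricci G b e) (ricci D M b e).
Proof.
move=> x Dx; rewrite /aricci eval_sum; apply: eq_bigr => a _.
by rewrite -represents_riemann_up.
Qed.

Section Scalar.
Variables (f : A) (phi : 'rV[R]_n -> R).
Hypothesis fphi : represents f phi.

Lemma represents_partial i : represents (apart G f i) (partial D phi i).
Proof. exact: represents_pd. Qed.

Lemma represents_grad k : represents (agrad G f k) (grad D M phi k).
Proof.
move=> x Dx; rewrite /agrad eval_sum; apply: eq_bigr => l _.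
by rewrite evalM -giE -represents_partial.
Qed.

Lemma represents_hess i j : represents (ahess G f i j) (hess D M phi i j).
Proof. exact/represents_nabla1/represents_partial. Qed.

Lemma represents_laplacian : represents (atrace G (ahess G f)) (laplacian D M phi).
Proof.
move=> x Dx; rewrite /atrace eval_sum; apply: eq_bigr => i _.
rewrite eval_sum; apply: eq_bigr => j _.
by rewrite evalM -giE -represents_hess.
Qed.
End Scalar.

Section Tensor.
Variables (T : 'I_n -> 'I_n -> A) (T' : 'I_n -> 'I_n -> 'rV[R]_n -> R).
Hypothesis TT : forall i j, represents (T i j) (T' i j).

Lemma represents_laplacian2 i j : represents (alapl2 G T i j) (laplacian2 D M T' i j).
Proof.
move=> x Dx; rewrite /alapl2 eval_sum; apply: eq_bigr => k _.
rewrite eval_sum; apply: eq_bigr => l _; rewrite evalM -giE; congr (_ * _).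
by apply: represents_nabla3 => a b c; exact: represents_nabla2.
Qed.

Lemma represents_lie2 X X' i j : (forall k, represents (X k) (X' k)) ->
  represents (alie2 G X T i j) (lie2 D X' T' i j).
Proof.
move=> XX x Dx; rewrite /alie2 eval_sum; apply: eq_bigr => k _.
rewrite !evalD !evalM -XX -!TT; congr (_ * _ + _ * _ + _ * _);
  exact: represents_pd.
Qed.

Lemma represents_raise1 k i : represents (araise1 G T k i) (raise1 M T' k i).
Proof.
move=> x Dx; rewrite /araise1 eval_sum; apply: eq_bigr => l _.
by rewrite evalM -giE -TT.
Qed.

Lemma represents_raise2 k l : represents (araise2 G T k l) (raise2 M T' k l).
Proof.
move=> x Dx; rewrite /araise2 eval_sum; apply: eq_bigr => a _.
rewrite eval_sum; apply: eq_bigr => b _.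
by rewrite !evalM -!giE -TT.
Qed.

Lemma represents_trace : represents (atrace G T)
  (fun x => \sum_i \sum_j gup M i j x * T' i j x).
Proof.
move=> x Dx; rewrite /atrace eval_sum; apply: eq_bigr => a _.
rewrite eval_sum; apply: eq_bigr => b _.
by rewrite evalM -giE -TT.
Qed.
End Tensor.
End Representation.

Section Spacetime.
Context {R : realType} {m : nat} (M : bmanifold R m).
Variables (J : set R) (c : chart M).
Hypothesis intervalJ : is_interval J.
Hypothesis nondegenerateJ : exists s t, [/\ J s, J t & s < t].

Lemma time_corner t : J t -> exists a r : R, [/\ a != 0, 0 < r &
  forall s, 0 <= s <= r -> J (t + s * a)].
Proof.
move=> Jt; have [s0 [s1 [Js0 Js1 s01]]] := nondegenerateJ.
have [lt_ts1|le_s1t] := ltP t s1.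
  exists 1, (s1 - t); split; rewrite ?oner_neq0 ?subr_gt0 // => s /andP[s_ge0 s_le].
  by apply: (intervalJ Jt Js1); rewrite mulr1; lra.
exists (-1), (t - s0); split; rewrite ?oppr_eq0 ?oner_neq0 ?subr_gt0 //.
  exact: lt_le_trans le_s1t.
by move=> s /andP[s_ge0 s_le]; apply: (intervalJ Js0 Jt); rewrite mulrN1; lra.
Qed.

Lemma space_corner (y u v : 'rV[R]_m.+1) : crange c y ->
  0 <= u 0 ord0 -> 0 <= v 0 ord0 -> exists2 r : R, 0 < r &
  forall s t, 0 <= s <= r -> 0 <= t <= r -> crange c (y + s *: u + t *: v).
Proof.
have [U openU OE] := crange_open c; rewrite /crange OE => -[Oy Hy] u0 v0.
have : nbhs y U by exact: open_nbhs_nbhs.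
move=> /nbhs_ballP[e /= e0 He].
pose K := `|u| + `|v| + 1; have K0 : 0 < K by rewrite ltr_wpDl // addr_ge0.
exists (e / (2 * K)); first by rewrite divr_gt0 // mulr_gt0.
move=> s t /andP[s0 sr] /andP[t0 tr]; split; last first.
  by rewrite /halfspace /= !mxE !addr_ge0 // mulr_ge0.
apply: He; rewrite -ball_normE /= -addrA opprD addrA subrr add0r normrN.
apply: (@le_lt_trans _ _ (e / 2)); last by lra.
apply: (le_trans (ler_normD _ _)); rewrite !normrZ !ger0_norm //.
have -> : e / 2 = e / (2 * K) * `|u| + e / (2 * K) * `|v| + e / (2 * K).
  by rewrite -[X in _ = _ + X]mulr1 -!mulrDr -/K; field; rewrite gt_eqF.
rewrite -[leLHS]addr0; apply: lerD; last by rewrite divr_ge0 ?ltW // mulr_gt0.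
by apply: lerD; apply: ler_wpM2r.
Qed.

Lemma spacetime_corner (x v w : (R * 'rV[R]_m.+1)%type) : (J `*` crange c) x ->
  spacetime_dirs R m.+1 v -> spacetime_dirs R m.+1 w ->
  exists a b r, [/\ a != 0, b != 0, 0 < r & forall s t : R,
    0 <= s <= r -> 0 <= t <= r -> (J `*` crange c) (x + s *: (a *: v) + t *: (b *: w))].
Proof.
move=> [Jx cx] Bv Bw; have [e [r1 [e0 r10 HJ]]] := time_corner Jx.
have normal_form u : spacetime_dirs R m.+1 u -> exists a k : R, exists z : 'rV[R]_m.+1,
    [/\ a != 0, 0 <= k <= 1, 0 <= z 0 ord0 & a *: u = (k * e, z)].
  case=> [->|[i _ <-]].
    exists e, 1, 0; split; rewrite ?mxE ?ler01 ?lexx //.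
    by congr pair; rewrite /= ?scaler0 // mul1r; exact: mulr1.
  exists 1, 0, (ebase i); split; rewrite ?oner_neq0 ?lexx ?ler01 //.
    by rewrite mxE; case: (_ && _).
  by rewrite scale1r mul0r.
have [a [k [z [a0 k01 z0 Ev]]]] := normal_form _ Bv.
have [b [l [y [b0 l01 y0 Ew]]]] := normal_form _ Bw.
have [r2 r20 Hc] := space_corner cx z0 y0.
exists a, b, (Num.min (r1 / 2) r2); split; rewrite ?lt_min ?divr_gt0 // => s t.
rewrite Ev Ew !le_min => /and3P[s0 s1 s2] /and3P[t0 t1 t2]; split; last first.
  by apply: Hc; rewrite ?s0 ?t0.
have -> : (x + s *: (k * e, z) + t *: (l * e, y)).1 = x.1 + (s * k + t * l) * e.
  by rewrite /= mulrDl addrA -!mulrA.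
apply: HJ; case/andP: k01 => k0 k1; case/andP: l01 => l0 l1; apply/andP; split.
  by rewrite addr_ge0 // mulr_ge0.
have : s * k <= r1 / 2 by rewrite -[leRHS]mulr1 ler_pM.
have : t * l <= r1 / 2 by rewrite -[leRHS]mulr1 ler_pM.
lra.
Qed.

Definition spacetime : cdomain (R * 'rV[R]_m.+1)%type := CDomain spacetime_corner.
End Spacetime.

Lemma posdef_unitmx (R : realType) n (G : 'M[R]_n) :
  (forall v : 'rV[R]_n, v != 0 -> 0 < (v *m G *m v^T) 0 0) -> G \in unitmx.
Proof.
move=> pd; rewrite -row_free_unit; apply: inj_row_free => v vG.
apply/eqP/negPn/negP => /pd; rewrite vG mul0mx mxE ltxx //.
Qed.

Lemma sfun_invmx (R : realType) (V : normedModType R) (W : cdomain V) n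
    (G : 'M[sfun W]_n) :
  (forall x (Wx : cd_set W x), map_mx (eval Wx) G \in unitmx) ->
  exists2 H : 'M[sfun W]_n, H *m G = 1%:M &
    forall x (Wx : cd_set W x), map_mx (eval Wx) H = invmx (map_mx (eval Wx) G).
Proof.
move=> uG; have [|b Gb] := @sfun_inv _ _ _ (\det G).
  move=> x Wx; have := uG x Wx; rewrite unitmxE unitfE.
  by rewrite -[eval Wx _]det_map_mx.
have HG : (b *: \adj G) *m G = 1%:M.
  by rewrite -scalemxAl mul_adj_mx scale_scalar_mx mulrC Gb.
exists (b *: \adj G) => // x Wx.
have := congr1 (map_mx (eval Wx)) HG; rewrite map_mxM map_mx1 => E.
by rewrite -[RHS]mul1mx -E (mulmxK (uG x Wx)).
Qed.

Lemma bpt_lift (R : realType) m (y : 'rV[R]_m) i : bpt y 0 (lift ord0 i) = y 0 i.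
Proof. by rewrite mxE liftK. Qed.

Lemma bpt_line (R : realType) m (y : 'rV[R]_m) h i :
  bpt (y + h *: ebase i) = bpt y + h *: ebase (lift ord0 i).
Proof.
apply/rowP => a; rewrite !mxE; case: (unliftP ord0 a) => [j|] -> /=.
  by rewrite !mxE (inj_eq lift_inj).
by rewrite mulr0 addr0.
Qed.

Lemma posdef_invmx (R : realType) n (G : 'M[R]_n) i : G^T = G ->
  (forall v : 'rV[R]_n, v != 0 -> 0 < (v *m G *m v^T) 0 0) -> 0 < invmx G i i.
Proof.
move=> Gs pd; have uG := posdef_unitmx pd.
have GT : (invmx G)^T = invmx G by rewrite trmx_inv Gs.
have := pd (row i (invmx G)); rewrite -row_mul mulVmx // tr_row GT row1 -rowE !mxE.
apply; apply/eqP => r0; have := congr1 (fun r => (r *m G) 0 i) r0.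
rewrite -row_mul mulVmx // row1 mul0mx !mxE !eqxx => /eqP.
by rewrite oner_eq0.
Qed.

Lemma quadratic_formE (R : realType) n (G : 'M[R]_n) (v : 'rV[R]_n) :
  (v *m G *m v^T) 0 0 = \sum_j (\sum_i v 0 i * G i j) * v 0 j.
Proof. by rewrite mxE; apply: eq_bigr => j _; rewrite !mxE. Qed.

Lemma posdef_induced (R : realType) m (G : 'M[R]_m.+1) :
  (forall v : 'rV[R]_m.+1, v != 0 -> 0 < (v *m G *m v^T) 0 0) ->
  forall v : 'rV[R]_m, v != 0 ->
  0 < (v *m (\matrix_(i, j) G (lift ord0 i) (lift ord0 j)) *m v^T) 0 0.
Proof.
move=> pd v v0; have w0 : bpt v != 0.
  apply: contraNneq v0 => w0; apply/eqP/rowP => i.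
  by rewrite -bpt_lift w0 !mxE.
suff -> : (v *m (\matrix_(i, j) G (lift ord0 i) (lift ord0 j)) *m v^T) 0 0
  = (bpt v *m G *m (bpt v)^T) 0 0 by exact: pd.
have bpt0 : bpt v 0 ord0 = 0 by rewrite mxE unlift_none.
rewrite !quadratic_formE [RHS]big_ord_recl bpt0 mulr0 add0r.
apply: eq_bigr => j _; rewrite bpt_lift [in RHS]big_ord_recl bpt0 mul0r add0r.
by congr (_ * _); apply: eq_bigr => i _; rewrite bpt_lift mxE.
Qed.

Lemma unit_normal_spec (R : realType) m (G : 'rV[R]_m.+1 -> 'M[R]_m.+1) x (N : R) :
  G x \in unitmx -> 0 < N -> N * N * invmx (G x) ord0 ord0 = 1 ->
  unit_normal G x = N *: row ord0 (invmx (G x)).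
Proof.
move=> uG N0 NN; set w := row ord0 (invmx (G x)).
have w0 : w 0 ord0 = invmx (G x) ord0 ord0 by rewrite mxE.
have gi0 : 0 < invmx (G x) ord0 ord0.
  by rewrite -(pmulr_rgt0 _ (mulr_gt0 N0 N0)) NN.
have wG b : (w *m G x) 0 b = (b == ord0)%:R by rewrite -row_mul mulVmx // row1 mxE eqxx.
have low (v : 'rV[R]_m.+1) b : \sum_a gdn G a b x * v 0 a = (v *m G x) 0 b.
  by rewrite mxE; apply: eq_bigr => a _; rewrite mulrC.
have nrm (v : 'rV[R]_m.+1) : \sum_a \sum_b gdn G a b x * v 0 a * v 0 b = \sum_b (v *m G x) 0 b * v 0 b.
  by rewrite exchange_big; apply: eq_bigr => b _; rewrite -low mulr_suml.
have delta (l : R) (v : 'rV[R]_m.+1) : \sum_b (l *: w *m G x) 0 b * v 0 b = l * v 0 ord0.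
  rewrite big_ord_recl big1 => [|i _]; last by rewrite -scalemxAl mxE wG mulr0 mul0r.
  by rewrite -scalemxAl mxE wG eqxx mulr1 addr0.
have Nnormal : inward_unit_normal G x (N *: w).
  split=> [i||]; last by rewrite mxE w0 mulr_gt0.
    by rewrite low -scalemxAl mxE wG mulr0.
  by rewrite nrm delta mxE w0 mulrA.
apply: xget_unique => // v [v1 v2 v3].
set l := (v *m G x) 0 ord0.
have vE : v = l *: w.
  rewrite -[LHS](mulmxK uG); apply/rowP => b.
  rewrite mxE big_ord_recl big1 => [|i _]; last by rewrite -low v1 mul0r.
  by rewrite addr0 [RHS]mxE; congr (_ * _); rewrite mxE.
have vl : 0 < l.
  by move: v3; rewrite vE mxE w0 pmulr_lgt0.
move: v2; rewrite nrm vE delta mxE w0 mulrA => v2; congr (_ *: _).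
have : (l - N) * (l + N) * invmx (G x) ord0 ord0 = 0.
  by rewrite -[RHS](subrr 1) -{1}v2 -NN; ring.
move=> /eqP; rewrite !mulf_eq0 (gt_eqF gi0) orbF (gt_eqF (addr_gt0 vl N0)) orbF.
by rewrite subr_eq0 => /eqP.
Qed.

Section FixedChart.
Context {R : realType} {m : nat} (M : bmanifold R m) (J : set R) (c : chart M).
Hypothesis intervalJ : is_interval J.
Hypothesis nondegenerateJ : exists s t, [/\ J s, J t & s < t].
Variable g : chart M -> R -> 'rV[R]_m.+1 -> 'M[R]_m.+1.
Hypothesis smooth_g : smooth_metrics J g.
Variable f : R -> M -> R.
Hypothesis smooth_f : smooth_functions J f.

Local Notation W := (spacetime c intervalJ nondegenerateJ).
Local Notation A := (sfun W).
Local Notation tg := (lift ord0).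

Lemma time_dir : cd_dirs W (1, 0). Proof. by left. Qed.
Lemma space_dir a : cd_dirs W (0, ebase a). Proof. by right; exists a. Qed.
Lemma in_spacetime t x : J t -> crange c x -> cd_set W (t, x).
Proof. by []. Qed.

Definition dspace a : A -> A := diff (space_dir a).
Definition dtime : A -> A := diff time_dir.

Lemma metric_algebraic a b : algebraic W (fun z => g c z.1 z.2 a b).
Proof. by apply: AlgSmooth; case: smooth_g => sg _ _ _; exact: sg. Qed.

Lemma potential_algebraic : algebraic W (fun z => in_chart c (f z.1) z.2).
Proof. by apply: AlgSmooth; exact: smooth_f. Qed.

Definition metric_coef a b : A := mk_sfun (metric_algebraic a b).
Definition potential_coef : A := mk_sfun potential_algebraic.

Lemma metric_coefE z (Wz : cd_set W z) a b : eval Wz (metric_coef a b) = g c z.1 z.2 a b.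
Proof. exact: mk_sfunE. Qed.

Lemma metric_sym z (Wz : cd_set W z) : (g c z.1 z.2)^T = g c z.1 z.2.
Proof. by case: Wz => Jz cz; case: smooth_g => _ + _ _; apply. Qed.

Lemma metric_pos z (Wz : cd_set W z) (v : 'rV[R]_m.+1) : v != 0 ->
  0 < (v *m g c z.1 z.2 *m v^T) 0 0.
Proof. by case: Wz => Jz cz; case: smooth_g => _ _ + _; apply. Qed.

Lemma metric_coef_sym a b : metric_coef a b = metric_coef b a.
Proof.
apply: eval_eq => z Wz; rewrite !metric_coefE -{1}(metric_sym Wz) mxE //.
Qed.

Lemma half_cst : sf_cst 2^-1 * 2 = 1 :> A.
Proof.
apply: eval_eq => z Wz; rewrite evalM eval_cst eval1 -[2]/(1 + 1) evalD eval1.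
by rewrite mulVf // pnatr_eq0.
Qed.

Lemma ambient_geometry : exists G : ageom A m.+1,
  [/\ ag_half G = sf_cst 2^-1, ag_d G = dspace, ag_g G = metric_coef &
    forall z (Wz : cd_set W z) a b,
      eval Wz (ag_gi G a b) = invmx (g c z.1 z.2) a b].
Proof.
pose X : 'M[A]_m.+1 := \matrix_(a, b) metric_coef a b.
have XE z (Wz : cd_set W z) : map_mx (eval Wz) X = g c z.1 z.2.
  by apply/matrixP => a b; rewrite !mxE metric_coefE.
have [|H HX HE] := @sfun_invmx _ _ W _ X.
  by move=> z Wz; rewrite XE; apply: posdef_unitmx => v; exact: metric_pos.
have HXE a b : \sum_l H a l * metric_coef l b = (a == b)%:R.
  have := congr1 (fun Y : 'M[A]_m.+1 => Y a b) HX; rewrite !mxE => <-.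
  by apply: eq_bigr => l _; rewrite mxE.
exists (@AGeom A m.+1 (sf_cst 2^-1) dspace metric_coef (fun a b => H a b) half_cst
  (fun a => diff_derivation (space_dir a))
  (fun a b => diff_comm (space_dir a) (space_dir b)) metric_coef_sym HXE).
split=> // z Wz a b /=; have := HE z Wz; rewrite XE => <-.
by rewrite mxE.
Qed.

Lemma leaf_metric_inverse : exists2 ghi : 'I_m -> 'I_m -> A,
  forall i j, \sum_l ghi i l * metric_coef (tg l) (tg j) = (i == j)%:R &
  forall z (Wz : cd_set W z) i j, eval Wz (ghi i j) =
    invmx (\matrix_(i, j) g c z.1 z.2 (tg i) (tg j)) i j.
Proof.
pose X : 'M[A]_m := \matrix_(a, b) metric_coef (tg a) (tg b).
have XE z (Wz : cd_set W z) : map_mx (eval Wz) X = \matrix_(i, j) g c z.1 z.2 (tg i) (tg j).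
  by apply/matrixP => a b; rewrite !mxE metric_coefE.
have [|H HX HE] := @sfun_invmx _ _ W _ X.
  move=> z Wz; rewrite XE; apply: posdef_unitmx; apply: posdef_induced => v.
  exact: metric_pos.
exists (fun i j => H i j) => [i j|z Wz i j].
  have := congr1 (fun Y : 'M[A]_m => Y i j) HX; rewrite !mxE => <-.
  by apply: eq_bigr => l _; rewrite mxE.
by have := HE z Wz; rewrite XE => <-; rewrite mxE.
Qed.

Lemma normal_length (G : ageom A m.+1) :
  (forall z (Wz : cd_set W z) a b, eval Wz (ag_gi G a b) = invmx (g c z.1 z.2) a b) ->
  exists2 N : A, N * N * ag_gi G ord0 ord0 = 1 &
    forall z (Wz : cd_set W z), 0 < eval Wz N.
Proof.
move=> giE; have gi_pos z (Wz : cd_set W z) : 0 < eval Wz (ag_gi G ord0 ord0).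
  rewrite giE; apply: posdef_invmx; first exact: metric_sym.
  by move=> v; exact: metric_pos.
have [|b gib] := @sfun_inv _ _ W (ag_gi G ord0 ord0).
  by move=> z Wz; rewrite gt_eqF.
have [|N NE N0] := @sfun_sqrt _ _ W b; last by exists N; rewrite // NE mulrC.
move=> z Wz; have := congr1 (eval Wz) gib; rewrite evalM eval1 => E.
by rewrite -(pmulr_rgt0 _ (gi_pos z Wz)) E.
Qed.

Lemma eval_dspace a (F : A) t x (Jt : J t) (cx : crange c x) :
  pd (crange c) (ebase a) (fun y => F (t, y)) x = eval (in_spacetime Jt cx) (dspace a F).
Proof.
rewrite /eval mk_sfunE // /pd; congr (lim _).
apply: (@dquot_pullback _ _ _ (cd_set W) (crange c) (fun y => (t, y))).
  by move=> y; apply/propext; split=> [|[]].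
by move=> h; congr pair => /=; rewrite scaler0 addr0.
Qed.

Lemma eval_dleaf i (F : A) t y (Jt : J t) (Dy : bdry c y) :
  pd (bdry c) (ebase i) (fun z => F (t, bpt z)) y =
  eval (in_spacetime Jt Dy) (dspace (tg i) F).
Proof.
rewrite /eval mk_sfunE // /pd; congr (lim _).
apply: (@dquot_pullback _ _ _ (cd_set W) (bdry c) (fun y => (t, bpt y))).
  by move=> z; apply/propext; split=> [|[]].
by move=> h; rewrite bpt_line; congr pair => /=; rewrite scaler0 addr0.
Qed.

Lemma is_pd_dtime (F : A) (phi : R -> R) t x (Jt : J t) (cx : crange c x) :
  (forall s, J s -> phi s = F (s, x)) ->
  is_pd J 1 phi t (eval (in_spacetime Jt cx) (dtime F)).
Proof.
move=> phiF; apply: (@is_pd_ext _ _ J 1 (fun s => F (s, x))) => //.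
  by move=> s Js; rewrite phiF.
rewrite /is_pd (@dquot_pullback _ _ _ (cd_set W) J (fun s => (s, x)) 1 (1, 0) F).
- exact: is_pd_diff.
- by move=> s; apply/propext; split=> [|[]].
- by move=> h; congr pair; rewrite /= scaler0 addr0.
Qed.

Lemma dtime_unique (F : A) (phi : R -> R) t x (Jt : J t) (cx : crange c x) l :
  (forall s, J s -> phi s = F (s, x)) -> is_pd J 1 phi t l ->
  eval (in_spacetime Jt cx) (dtime F) = l.
Proof.
move=> phiF Hl; rewrite /eval mk_sfunE //; apply: (pdE (in_spacetime Jt cx) time_dir).
have : is_pd J 1 (fun s => F (s, x)) t l by exact: is_pd_ext Hl.
rewrite /is_pd (@dquot_pullback _ _ _ (cd_set W) J (fun s => (s, x)) 1 (1, 0) F) //.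
- by move=> s; apply/propext; split=> [|[]].
- by move=> h; congr pair; rewrite /= scaler0 addr0.
Qed.

Lemma dleaf_eq0 i (F : A) t (Jt : J t) :
  (forall y (Dy : bdry c y), eval (in_spacetime Jt Dy) F = 0) ->
  forall y (Dy : bdry c y), eval (in_spacetime Jt Dy) (dspace (tg i) F) = 0.
Proof.
move=> F0 y Dy; rewrite /eval mk_sfunE //.
apply: (pdE (in_spacetime Jt Dy) (space_dir (tg i))).
rewrite /is_pd -(@dquot_pullback _ _ _ (cd_set W) (bdry c) (fun y => (t, bpt y)) (ebase i)).
- apply: is_pd_ext (is_pd_cst _ _ 0 _) => // z bz; exact: esym (F0 z bz).
- by move=> z; apply/propext; split=> [|[]].
- by move=> h; rewrite bpt_line; congr pair => /=; rewrite scaler0 addr0.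
Qed.

Section Evaluation.
Variables (G : ageom A m.+1) (ghi : 'I_m -> 'I_m -> A) (N : A).
Hypotheses (halfG : ag_half G = sf_cst 2^-1) (dG : ag_d G = dspace) (gG : ag_g G = metric_coef)
  (giG : forall z (Wz : cd_set W z) a b,
    eval Wz (ag_gi G a b) = invmx (g c z.1 z.2) a b)
  (ghi_g : forall i j, \sum_l ghi i l * ag_g G (tg l) (tg j) = (i == j)%:R)
  (ghiE : forall z (Wz : cd_set W z) i j, eval Wz (ghi i j) =
    invmx (\matrix_(i, j) g c z.1 z.2 (tg i) (tg j)) i j)
  (NN : N * N * ag_gi G ord0 ord0 = 1)
  (N_gt0 : forall z (Wz : cd_set W z), 0 < eval Wz N).
Variables (t : R) (Jt : J t).

Local Notation nu := (N *: dual G ord0).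
Local Notation L := (leaf ghi_g).
Local Notation Asff := (asff G nu).
Local Notation gt_ := (g c t).
Local Notation gb := (induced_metric gt_).
Local Notation Dp := (fun x (cx : crange c x) => in_spacetime Jt cx).
Local Notation Bp := (fun y (Dy : bdry c y) => @in_spacetime t (bpt y) Jt Dy).
Local Notation rep := (@represents _ _ W m.+1 (crange c) (fun x => (t, x)) Dp).
Local Notation repb := (@represents _ _ W m (bdry c) (fun y => (t, bpt y)) Bp).

Lemma rep_pdE a (F : A) x (cx : crange c x) :
  pd (crange c) (ebase a) (fun y => F (t, y)) x = eval (Dp x cx) (ag_d G a F).
Proof. by rewrite dG; exact: eval_dspace. Qed.
Lemma rep_halfE x (cx : crange c x) : eval (Dp x cx) (ag_half G) = 2^-1.
Proof. by rewrite halfG eval_cst. Qed.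
Lemma rep_gE a b : rep (ag_g G a b) (gdn gt_ a b).
Proof. by move=> x cx; rewrite gG metric_coefE. Qed.
Lemma rep_giE a b : rep (ag_gi G a b) (gup gt_ a b).
Proof. by move=> x cx; rewrite giG. Qed.

Lemma repb_pdE i (F : A) y (Dy : bdry c y) :
  pd (bdry c) (ebase i) (fun z => F (t, bpt z)) y = eval (Bp y Dy) (ag_d L i F).
Proof. by rewrite /= dG; exact: eval_dleaf. Qed.
Lemma repb_halfE y (Dy : bdry c y) : eval (Bp y Dy) (ag_half L) = 2^-1.
Proof. by rewrite /= halfG eval_cst. Qed.
Lemma repb_gE i j : repb (ag_g L i j) (gdn gb i j).
Proof. by move=> y Dy; rewrite /= gG metric_coefE /gdn mxE. Qed.
Lemma repb_giE i j : repb (ag_gi L i j) (gup gb i j).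
Proof. by move=> y Dy; rewrite /= ghiE. Qed.

Lemma unit_normalE x (cx : crange c x) a :
  unit_normal gt_ x 0 a = eval (Dp x cx) (nu 0 a).
Proof.
rewrite (@unit_normal_spec _ _ _ _ (eval (Dp x cx) N)).
- by rewrite !mxE evalM giG.
- by apply: posdef_unitmx => v; exact: (metric_pos (Dp x cx)).
- exact: N_gt0.
- by have := congr1 (eval (Dp x cx)) NN; rewrite !evalM giG eval1.
Qed.

Lemma repb_sff i j : repb (Asff i j) (sff (crange c) gt_ i j).
Proof.
move=> y Dy; rewrite /asff /ip /bil /lin eval_sum; apply: eq_bigr => a _.
rewrite evalM eval_sum mulr_suml; apply: eq_bigr => b _.
rewrite cov_bvec [(\row__ _) 0 b]mxE evalM -unit_normalE -rep_gE.
rewrite -(represents_christoffel rep_pdE rep_halfE rep_gE rep_giE).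
by rewrite mulrAC.
Qed.

Lemma repb_mean : repb (amean ghi_g nu) (mean_curv (crange c) gt_).
Proof. by move=> y Dy; exact: (represents_trace repb_giE repb_sff Dy). Qed.

Lemma rep_potential : rep (potential_coef) (in_chart c (f t)).
Proof. by move=> x cx; rewrite /eval mk_sfunE. Qed.

Lemma repb_potential : repb potential_coef (fun z => in_chart c (f t) (bpt z)).
Proof. by move=> y Dy; rewrite /eval mk_sfunE. Qed.

Lemma repb_ricci i j :
  repb (aricci G (tg i) (tg j)) (ricci_tan (crange c) gt_ i j).
Proof.
move=> y Dy.
exact: (represents_ricci rep_pdE rep_halfE rep_gE rep_giE (tg i) (tg j) Dy).
Qed.

Lemma repb_riemann i j k l : repb (ariem G (tg i) (tg j) (tg k) (tg l))
  (riemann_tan (crange c) gt_ i j k l).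
Proof.
move=> y Dy.
exact: (represents_riemann rep_pdE rep_halfE rep_gE rep_giE _ _ _ _ Dy).
Qed.

Lemma repb_riemann_trace k j : repb (RmTr G ghi k j)
  (riemann_tan_trace (crange c) gt_ k j).
Proof.
move=> y Dy; rewrite /RmTr eval_sum; apply: eq_bigr => l _.
rewrite eval_sum; apply: eq_bigr => q _.
by rewrite evalM -repb_riemann -repb_giE.
Qed.

Lemma repb_nabla0_riemann i j : repb (nab0_riem G nu i j)
  (nabla0_riemann (crange c) gt_ i j).
Proof.
move=> y Dy; rewrite /nab0_riem eval_sum; apply: eq_bigr => a _.
rewrite eval_sum; apply: eq_bigr => b _; rewrite eval_sum; apply: eq_bigr => e _.
rewrite 3!evalM -!unit_normalE; congr (_ * _).
apply: (represents_nabla4 rep_pdE rep_halfE rep_gE rep_giE).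
exact: (represents_riemann rep_pdE rep_halfE rep_gE rep_giE).
Qed.

Lemma repb_nabla0_ricci : repb (nab0_ric G nu) (nabla0_ricci (crange c) gt_).
Proof.
move=> y Dy; rewrite /nab0_ric eval_sum; apply: eq_bigr => a _.
rewrite eval_sum; apply: eq_bigr => b _; rewrite eval_sum; apply: eq_bigr => e _.
rewrite 3!evalM -!unit_normalE; congr (_ * _).
apply: (represents_nabla2 rep_pdE rep_halfE rep_gE rep_giE).
exact: (represents_ricci rep_pdE rep_halfE rep_gE rep_giE).
Qed.

Lemma repb_normal_deriv : repb (normal_df G nu potential_coef)
  (normal_deriv (crange c) gt_ (in_chart c (f t))).
Proof.
move=> y Dy; rewrite /normal_df /lin eval_sum; apply: eq_bigr => a _.
by rewrite evalM -unit_normalE mulrC -(represents_partial rep_pdE rep_potential).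
Qed.

Lemma eval_flow_g a b x (cx : crange c x) :
  eval (Dp x cx) (aricci G a b + ahess G potential_coef a b) =
  ricci (crange c) gt_ a b x + hess (crange c) gt_ (in_chart c (f t)) a b x.
Proof.
rewrite evalD -(represents_ricci rep_pdE rep_halfE rep_gE rep_giE); congr (_ + _).
by rewrite -(represents_hess rep_pdE rep_halfE rep_gE rep_giE rep_potential).
Qed.

Lemma eval_ahess0 u : (forall y (Dy : bdry c y), eval (Bp y Dy) u = 0) ->
  forall i j y (Dy : bdry c y), eval (Bp y Dy) (ahess L u i j) = 0.
Proof.
move=> u0 i j y Dy.
have d0 : forall i y (Dy : bdry c y), eval (Bp y Dy) (ag_d L i u) = 0.
  by move=> k; rewrite /= dG; exact: dleaf_eq0.
rewrite /ahess /anab1 /apart evalB eval_sum big1 => [|l _]; last by rewrite evalM d0 mulr0.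
by rewrite subr0 /= dG; apply: (@dleaf_eq0 i) => z bz; have := d0 j z bz; rewrite /= dG.
Qed.
End Evaluation.

End FixedChart.

Section EvalPolynomials.
Context {R : realType} {V : normedModType R} {W : cdomain V} (x : V) (Wx : cd_set W x).
Implicit Types a b u v w : sfun W.
Local Notation E := (eval Wx).
Let evalE := (@eval_nat R V W x Wx, @evalD R V W x Wx, @evalB R V W x Wx,
  @evalN R V W x Wx, @evalM R V W x Wx).

Lemma eval_flow_metric a1 a2 a3 a4 u : E u = 0 ->
  E (- a1 - 2 * a2 - 2 * a3 * a4 + 2 * u * a4) = - E a1 - 2 * E a2 - 2 * E a3 * E a4.
Proof. by move=> u0; rewrite !evalE u0 mulr0 mul0r addr0. Qed.

Lemma eval_flow_asff a1 a2 a3 a4 a5 a6 a7 a8 a9 b u v w : E v = 0 -> E u = 0 ->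
  E (a1 - a2 - a3 - a4 + 2 * a5 - 2 * a6 * a7 + a8 * a9 + b - v + u * w) =
  E a1 - E a2 - E a3 - E a4 + 2 * E a5 - 2 * E a6 * E a7 + E a8 * E a9 + E b.
Proof. by move=> v0 u0; rewrite !evalE u0 v0 mul0r subr0 addr0. Qed.

Lemma eval_flow_mean a1 a2 a3 a4 a5 b u v w : E v = 0 -> E u = 0 ->
  E (a1 - a2 + 2 * a3 + a4 * a5 + b - v - u * w) =
  E a1 - E a2 + 2 * E a3 + E a4 * E a5 + E b.
Proof. by move=> v0 u0; rewrite !evalE u0 v0 mul0r !subr0. Qed.
End EvalPolynomials.

Unset Implicit Arguments.
Set Strict Implicit.
Set Printing Implicit Defensive.

Theorem theorem3 (R : realType) (m : nat) (M : bmanifold R m)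
  (compactM : compact [set: M])
  (J : set R) (intervalJ : is_interval J)
  (nondegenerateJ : exists s t, [/\ J s, J t & s < t])
  (g : chart M -> R -> 'rV[R]_m.+1 -> 'M[R]_m.+1) (smooth_g : smooth_metrics J g)
  (f : R -> M -> R) (smooth_f : smooth_functions J f)
  (boundary_condition : forall c t y, J t -> bdry c y ->
     mean_curv (crange c) (g c t) y
     + normal_deriv (crange c) (g c t) (in_chart c (f t)) y = 0)
  (flow_g : forall c t x a b, J t -> crange c x ->
     is_pd J 1 (fun s => g c s x a b) t
       (- 2 * (ricci (crange c) (g c t) a b x
               + hess (crange c) (g c t) (in_chart c (f t)) a b x)))
  (flow_f : forall c t x, J t -> crange c x ->
     is_pd J 1 (fun s => in_chart c (f s) x) t
       (- laplacian (crange c) (g c t) (in_chart c (f t)) x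
        - scalar_curv (crange c) (g c t) x)) :
  forall (c : chart M) (t : R) (y : 'rV[R]_m), J t -> bdry c y ->
    let gb := induced_metric (g c t) in
    let fb := fun z : 'rV[R]_m => in_chart c (f t) (bpt z) in
    let gradf := grad (bdry c) gb fb in
    let A := sff (crange c) (g c t) in
    let H := mean_curv (crange c) (g c t) in
    let Rm := riemann_tan (crange c) (g c t) in
    let RmTr := riemann_tan_trace (crange c) (g c t) in
    let Rc := ricci_tan (crange c) (g c t) in
    let Amix := raise1 gb A in
    let Aup := raise2 gb A in
    let normA2 := \sum_k \sum_l Aup k l y * A k l y in
    [/\ forall i j : 'I_m,
          is_pd J 1 (fun s => induced_metric (g c s) y i j) t
            (- lie2 (bdry c) gradf (gdn gb) i j y
             - 2 * Rc i j y - 2 * H y * A i j y),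
        forall i j : 'I_m,
          is_pd J 1 (fun s => sff (crange c) (g c s) i j y) t
            (laplacian2 (bdry c) gb A i j y
             - lie2 (bdry c) gradf A i j y
             - \sum_k Amix k i y * RmTr k j y
             - \sum_k Amix k j y * RmTr k i y
             + 2 * (\sum_k \sum_l Aup k l y * Rm k i l j y)
             - 2 * H y * (\sum_k A i k y * Amix k j y)
             + normA2 * A i j y
             + nabla0_riemann (crange c) (g c t) i j y) &
        is_pd J 1 (fun s => mean_curv (crange c) (g c s) y) t
          (laplacian (bdry c) gb H y
           - ginner gb gradf (grad (bdry c) gb H) y
           + 2 * (\sum_i \sum_j Aup i j y * Rc i j y)
           + normA2 * H y
           + nabla0_ricci (crange c) (g c t) y)].
Proof.
move=> c t y Jt cy gb fb gradf A H Rm RmT Rc Amix Aup nA2.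
have [G [halfG dG gG giG]] :=
  @ambient_geometry R m M J c intervalJ nondegenerateJ g smooth_g.
have [ghi ghi_gA ghiE] :=
  @leaf_metric_inverse R m M J c intervalJ nondegenerateJ g smooth_g.
have ghi_g i j : \sum_l ghi i l * ag_g G (lift ord0 l) (lift ord0 j) = (i == j)%:R.
  by rewrite gG.
have [N NN N0] := @normal_length R m M J c intervalJ nondegenerateJ g smooth_g G giG.
pose nu := N *: dual G ord0.
pose ft := potential_coef c intervalJ nondegenerateJ smooth_f.
pose D := @dtime R m M J c intervalJ nondegenerateJ.
have derD : derivation D by exact: diff_derivation.
have DC a x : D (ag_d G a x) = ag_d G a (D x) by rewrite dG; exact: diff_comm.
have flow a b : D (ag_g G a b) = - 2 * (aricci G a b + ahess G ft a b).
  apply: eval_eq => -[s x] [Js cx].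
  transitivity (- 2 * (ricci (crange c) (g c s) a b x
    + hess (crange c) (g c s) (in_chart c (f s)) a b x)).
    apply: (dtime_unique (phi := fun r => g c r x a b) Js cx); last exact: flow_g.
    by move=> r Jr; rewrite gG /metric_coef mk_sfunE.
  by rewrite evalM evalN eval_nat -(eval_flow_g smooth_f halfG dG gG giG Js).
pose B z (bz : bdry c z) := @in_spacetime R m M J c intervalJ nondegenerateJ t (bpt z) Jt bz.
have nuE : nu = N *: dual G ord0 by [].
have mean := repb_mean halfG dG gG giG ghi_g ghiE NN N0 Jt.
have sffR := repb_sff halfG dG gG giG NN N0 Jt.
have u0 : forall z (bz : bdry c z), eval (B z bz) (defect ghi_g nu ft) = 0.
  move=> z bz; rewrite /defect evalD -mean.
  rewrite -(repb_normal_deriv smooth_g smooth_f dG giG NN N0 Jt).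
  exact: boundary_condition.
have h0 := eval_ahess0 dG ghi_g u0.
have pdR := repb_pdE dG ghi_g Jt.
have halfR := repb_halfE halfG ghi_g Jt.
have gR := repb_gE gG ghi_g Jt.
have giR := repb_giE ghi_g ghiE Jt.
have gradR := represents_grad pdR giR (repb_potential intervalJ nondegenerateJ smooth_f Jt).
have normR : eval (B y cy) (normA2 ghi_g nu) = nA2.
  rewrite /normA2 eval_sum; apply: eq_bigr => k _; rewrite eval_sum.
  apply: eq_bigr => l _; rewrite evalM -sffR; congr (_ * _).
  by rewrite -(represents_raise2 giR sffR).
split=> [i j|i j|].
- have <- : eval (B y cy) (D (ag_g G (lift ord0 i) (lift ord0 j))) =
      - lie2 (bdry c) gradf (gdn gb) i j y - 2 * Rc i j y - 2 * H y * A i j y.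
    rewrite (flow_metric ghi_g NN nuE flow).
    rewrite (eval_flow_metric _ _ _ _ (u0 y cy)).
    rewrite -mean -sffR -(repb_ricci halfG dG gG giG Jt).
    by rewrite -(represents_lie2 pdR gR i j gradR cy).
  by apply: is_pd_dtime => s Js; rewrite gG /metric_coef mk_sfunE // /induced_metric mxE.
- have <- : eval (B y cy) (D (asff G nu i j)) =
      laplacian2 (bdry c) gb A i j y - lie2 (bdry c) gradf A i j y
      - \sum_k Amix k i y * RmT k j y - \sum_k Amix k j y * RmT k i y
      + 2 * (\sum_k \sum_l Aup k l y * Rm k i l j y)
      - 2 * H y * (\sum_k A i k y * Amix k j y) + nA2 * A i j y
      + nabla0_riemann (crange c) (g c t) i j y.
    rewrite (flow_asff ghi_g NN nuE derD DC flow).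
    rewrite (eval_flow_asff _ _ _ _ _ _ _ _ _ _ _ (h0 j i y cy) (u0 y cy)).
    rewrite -mean -sffR normR -(repb_nabla0_riemann halfG dG gG giG NN N0 Jt).
    rewrite -(represents_laplacian2 pdR halfR gR giR sffR) /lieX.
    rewrite -(represents_lie2 pdR sffR i j gradR cy).
    have tr a b : eval (B y cy) (ARmTr ghi_g nu a b) = \sum_k Amix k a y * RmT k b y.
      rewrite /ARmTr eval_sum; apply: eq_bigr => k _; rewrite evalM.
      rewrite -(repb_riemann_trace halfG dG gG giG ghi_g ghiE Jt k b cy).
      by rewrite -(represents_raise1 giR sffR k a cy).
    have ar : eval (B y cy) (ARm ghi_g nu i j) = \sum_k \sum_l Aup k l y * Rm k i l j y.
      rewrite /ARm eval_sum; apply: eq_bigr => k _; rewrite eval_sum.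
      apply: eq_bigr => l _; rewrite evalM.
      rewrite -(repb_riemann halfG dG gG giG Jt k i l j cy).
      by rewrite -(represents_raise2 giR sffR k l cy).
    have sq : eval (B y cy) (Asq ghi_g nu i j) = \sum_k A i k y * Amix k j y.
      rewrite AsqE eval_sum; apply: eq_bigr => k _; rewrite evalM -(sffR i k y cy).
      by rewrite -(represents_raise1 giR sffR k j cy).
    congr (_ - _ - _ - _ + 2 * _ - 2 * _ * _ + _ + _);
      [exact: tr|exact: tr|exact: ar|exact: sq].
  by apply: is_pd_dtime => s Js; exact: (repb_sff halfG dG gG giG NN N0 Js i j cy).
- have <- : eval (B y cy) (D (amean ghi_g nu)) =
      laplacian (bdry c) gb H y - ginner gb gradf (grad (bdry c) gb H) y
      + 2 * (\sum_i \sum_j Aup i j y * Rc i j y) + nA2 * H y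
      + nabla0_ricci (crange c) (g c t) y.
    have tr0 : eval (B y cy) (atrace (leaf ghi_g)
        (ahess (leaf ghi_g) (defect ghi_g nu ft))) = 0.
      rewrite /atrace eval_sum big1 // => i _; rewrite eval_sum big1 // => j _.
      by rewrite evalM (h0 i j y cy) mulr0.
    rewrite (flow_mean ghi_g NN nuE derD DC flow).
    rewrite (eval_flow_mean _ _ _ _ _ _ _ tr0 (u0 y cy)).
    rewrite -mean normR -(repb_nabla0_ricci halfG dG gG giG NN N0 Jt cy).
    rewrite -(represents_laplacian pdR halfR gR giR mean cy).
    congr (_ - _ + 2 * _ + _ + _).
      rewrite eval_sum; apply: eq_bigr => i _; rewrite eval_sum; apply: eq_bigr => j _.
      rewrite 2!evalM -(gR i j y cy) -(gradR i y cy).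
      by rewrite -(represents_grad pdR giR mean j cy).
    rewrite eval_sum; apply: eq_bigr => i _; rewrite eval_sum; apply: eq_bigr => j _.
    rewrite evalM -(repb_ricci halfG dG gG giG Jt i j cy).
    by rewrite -(represents_raise2 giR sffR i j cy).
  by apply: is_pd_dtime => s Js;
    exact: (repb_mean halfG dG gG giG ghi_g ghiE NN N0 Js cy).
Qed.
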